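(* Let $A$ be a unital semisimple commutative Banach algebra and $B$ a unital commutative Banach algebra. Suppose that $T$ is a map from $A^{-1}$ onto $B^{-1}$ and that there exists a nonzero complex number $\alpha$ such that $$\sigma_{\pi}(Tf\,Tg-\alpha)\cap\sigma_{\pi}(fg-\alpha)\neq\emptyset$$ holds for every pair $f$ and $g$ in $A^{-1}$. Then $B$ is semisimple, and $T$ is extended to a map $T_E$ from $\mathrm{cl}\,A$ onto $\mathrm{cl}\,B$ with $T_EA=B$, and there exists a homeomorphism $\phi$ from $\mathrm{Ch}(\mathrm{cl}\,B)$ onto $\mathrm{Ch}(\mathrm{cl}\,A)$ such that the equality $$T_Ef(y)=T1(y)\,f(\phi(y)),\quad y\in\mathrm{Ch}(\mathrm{cl}\,B)$$ holds for every $f\in\mathrm{cl}\,A$. In particular, $\frac{T}{T1}$ (the map $f\mapsto Tf/T1$) is extended to a complex-algebra isomorphism $\frac{T_E}{T1}$ from $\mathrm{cl}\,A$ onto $\mathrm{cl}\,B$ with $\frac{T_E}{T1}(A)=B$.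
   Context: Banach algebras are over $\mathbb{C}$. $A^{-1}$ is the group of invertible elements of $A$. The peripheral spectrum of $f$ is $\sigma_{\pi}(f)=\{z\in\sigma(f):|z|=\mathrm{r}(f)\}$, where $\sigma(f)$ is the spectrum and $\mathrm{r}(f)$ the spectral radius. $M_A$ is the maximal ideal space of $A$. $\mathrm{cl}\,A$ is the closure, in the supremum norm, of the Gelfand transform $\hat A$ in $C(M_A)$; it is a uniform algebra on $M_A$, i.e. a uniformly closed subalgebra of $C(M_A)$ containing the constants and separating points. If $A$ is semisimple, elements of $A$ are identified with their Gelfand transforms, so that $A\subset\mathrm{cl}\,A\subset C(M_A)$. $\mathrm{Ch}(\mathrm{cl}\,A)\subset M_A$ is the Choquet boundary of $\mathrm{cl}\,A$. $T$ is not assumed to be linear or multiplicative. *)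

(* Defs.v *)
From HB Require Import structures.
From mathcomp Require Import all_boot all_order all_algebra.
From mathcomp Require Import ring_quotient complex.
From mathcomp Require Import all_classical all_reals all_analysis.

Set Implicit Arguments.
Unset Strict Implicit.
Unset Printing Implicit Defensive.

Import Order.TTheory GRing.Theory Num.Theory.
Import numFieldNormedType.Exports.

Local Open Scope classical_set_scope.
Local Open Scope complex_scope.
Local Open Scope ring_scope.

(* The usual topology of the complex numbers. *)
#[warnings="-redundant-canonical-projection"]
HB.instance Definition _ (R : realType) := NormedModule.copy R[i] R[i]^o.

(* A unital commutative complex Banach algebra.  Its norm is a separate,
   real-valued operation, because Hierarchy-Builder refuses a join of
   CompleteNormedModule with ring structures (the library has NumDomain below
   both).  No normalisation of the norm of 1 is imposed; 1 != 0 is part of the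
   ring structure, and the invertible elements are those of [GRing.unit]. *)
HB.mixin Record hasBanachNorm (R : realType) A of GRing.ComUnitAlgebra R[i] A := {
  bnorm : A -> R;
  bnorm_triangle : forall x y, bnorm (x + y) <= bnorm x + bnorm y;
  bnormZ : forall (a : R[i]) x, (bnorm (a *: x))%:C = `|a| * (bnorm x)%:C;
  bnorm_eq0 : forall x, bnorm x = 0 -> x = 0;
  bnorm_mul : forall x y, bnorm (x * y) <= bnorm x * bnorm y;
  bnorm_complete : forall u : nat -> A,
    (forall e : R, 0 < e -> exists N : nat, forall m n : nat,
       (N <= m)%N -> (N <= n)%N -> bnorm (u m - u n) < e) ->
    exists l : A, bnorm (u n - l) @[n --> \oo] --> (0 : R)
}.

#[short(type="comBanachAlgType")]
HB.structure Definition ComBanachAlgebra (R : realType) :=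
  {A of GRing.ComUnitAlgebra R[i] A & hasBanachNorm R A}.

Section BanachAlgebra.
Context {R : realType} {A : comBanachAlgType R}.

Definition spectrum (f : A) : set R[i] :=
  [set z | f - z%:A \isn't a GRing.unit].

(* The norm on R[i] is R[i]-valued, hence the real part. *)
Definition spectral_radius (f : A) : R :=
  sup [set complex.Re `|z| | z in spectrum f].

Definition peripheral_spectrum (f : A) : set R[i] :=
  [set z | spectrum f z /\ `|z| = (spectral_radius f)%:C].

End BanachAlgebra.

(* [idealr_closed] includes that the ideal is proper. *)
Definition maximal_ideal (A : comNzRingType) (M : {pred A}) : Prop :=
  idealr_closed M /\
  forall I : {pred A}, idealr_closed I -> {subset M <= I} -> {subset I <= M}.

(* Semisimple: the Jacobson radical is zero. *)
Definition semisimple (A : comNzRingType) : Prop :=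
  forall x : A, (forall M : {pred A}, maximal_ideal M -> x \in M) -> x = 0.

(* The maximal ideal space as the set of nonzero complex homomorphisms of A;
   as a subspace of {ptws A -> R[i]} it carries the Gelfand topology. *)
Definition characters (R : realType) (A : comBanachAlgType R) : set {ptws A -> R[i]} :=
  [set x | scalar (x : A -> R[i]) /\ monoid_morphism (x : A -> R[i])].
Arguments characters {R} A _.

Definition maxspec (R : realType) (A : comBanachAlgType R) : topologicalType :=
  set_type (characters A).

Definition gelfand (R : realType) (A : comBanachAlgType R) (f : A) (x : maxspec A) : R[i] :=
  set_val x f.

Definition hat (R : realType) (A : comBanachAlgType R) : set (maxspec A -> R[i]) :=
  range (@gelfand R A).
Arguments hat {R} A _.

(* The closure of [hat A] in C(M_A) for uniform convergence. *)
Definition cl (R : realType) (A : comBanachAlgType R) : set (maxspec A -> R[i]) :=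
  [set h : maxspec A -> R[i] | continuous h] `&`
  closure (hat A : set {uniform maxspec A -> R[i]}).
Arguments cl {R} A _.

Section Choquet.
Context {R : realType} {X : Type}.
Implicit Types (M : set (X -> R[i])) (L : (X -> R[i]) -> R[i]).

(* L restricts to a state of M: a linear functional on M with ||L|| = 1 = L 1,
   M being normed by the supremum norm.  Values of L outside M are irrelevant. *)
Definition is_state M L : Prop :=
  [/\ forall (a : R[i]) h k, M h -> M k -> L (a *: h + k) = a * L h + L k,
      L 1 = 1
    & forall h (r : R), M h -> (forall x, `|h x| <= r%:C) -> `|L h| <= r%:C].

(* Choquet boundary of M: the points whose evaluation functional is an extreme
   point of the state space of M. *)
Definition choquet M : set X :=
  [set y | forall L1 L2 (t : R), is_state M L1 -> is_state M L2 ->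
     0 < t < 1 ->
     (forall h, M h -> h y = t%:C * L1 h + (1 - t)%:C * L2 h) ->
     forall h, M h -> L1 h = h y /\ L2 h = h y].

End Choquet.

Definition homeomorphism (X Y : topologicalType) (phi : X -> Y) : Prop :=
  continuous phi /\
  exists psi : Y -> X, [/\ continuous psi, cancel phi psi & cancel psi phi].

(* S restricts to an isomorphism of complex unital algebras from M onto N. *)
Definition calg_iso (R : realType) (X Y : Type) (M : set (X -> R[i]))
    (N : set (Y -> R[i])) (S : (X -> R[i]) -> (Y -> R[i])) : Prop :=
  [/\ set_bij M N S,
      forall (a : R[i]) h k, M h -> M k -> S (a *: h + k) = a *: S h + S k,
      forall h k, M h -> M k -> S (h * k) = S h * S k
    & S 1 = 1].

(* Main.v *)
(** Let |f| be the spectral radius.  The hypothesis gives |Tf Tg - alpha| = |fg - alpha|,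
    with a common value of maximal modulus; letting scalars tend to infinity one gets
    |Tf Tg| = |fg|.  Estimates are made on a minimal closed boundary G of M_B: by minimality
    every point of G admits invertible functions w that peak near it, and w can be taken with
    values in a disc D internally tangent to the unit circle at 1.

    Testing the hypothesis with Tg = Kw, where K is a large scalar, yields T(cf) = c Tf.
    Hence |Tf Tg - c| = |fg - c| for every c, and T(1/f) = 1/Tf.  Put Sf = Tf T1, let w peak at
    a point y of G, let Ta = w T1, and let x be a point where |a| is maximal.  Then a(x) = 1,
    and both f(x) / Sf(y) and its inverse almost lie in D, so that f(x) is close to Sf(y),
    simultaneously for finitely many f.  Therefore S is additive and multiplicative on the
    invertible group and extends to an algebra isomorphism from A onto B, which induces a
    homeomorphism of M_B onto M_A carrying all the structure. *)

Require Import Defs.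
From HB Require Import structures.
From mathcomp Require Import all_boot all_order all_algebra.
From mathcomp Require Import ring_quotient complex.
From mathcomp Require Import all_classical all_reals all_analysis.
From mathcomp Require Import ring lra.

Set Implicit Arguments.
Unset Strict Implicit.
Unset Printing Implicit Defensive.

Import Order.TTheory GRing.Theory Num.Theory.
Import numFieldNormedType.Exports.

Local Open Scope classical_set_scope.
Local Open Scope complex_scope.
Local Open Scope ring_scope.

Local Notation normc := Normc.normc.
Local Notation Re := complex.Re.
Local Notation rho := spectral_radius.

(** * Complex numbers *)

(** The hypothesis speaks of invertible elements and of one fixed scalar only, and [T] has no
    algebraic property to start from. Large scalars make [alpha] negligible, but they cannot be
    moved through [T] before homogeneity is known; so they are first put on the values of [T], which
    surjectivity allows. The limit retains moduli only, and the phase of [T (c *: f)] has to be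
    recovered from the common peripheral value at large but finite scalars, up to errors of lower
    order.

    A point of the minimal boundary need not be a peak point, so a test function takes the value 1
    only near the chosen point. The bound |w| <= 1 would leave the argument of w free there; in the
    disc |w - 1/9| <= 8/9 the defect 1 - |w|^2 controls |1 - w|. For |b| <= 1 the function b (2 + b)
    / 3 lies in this disc, is invertible when b is, and equals 1 where b does.

    Choquet boundaries enter only at the end: they are defined by the function algebra alone, hence
    are carried along by the homeomorphism of maximal ideal spaces. *)

Section ComplexModulus.
Variable R : realType.
Implicit Types (z w : R[i]) (r : R).

Lemma normc_ge0 z : 0 <= normc z.
Proof. by rewrite -lecR; exact: (normr_ge0 z). Qed.

Lemma ler_normcD z w : normc (z + w) <= normc z + normc w.
Proof. exact: le_normcD. Qed.

Lemma normcB z w : normc (z - w) = normc (w - z).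
Proof. by rewrite -[in LHS](opprB w z) normcN. Qed.

Lemma normc_gt0 z : (0 < normc z) = (z != 0).
Proof. by rewrite -ltcR; exact: (normr_gt0 z). Qed.

Lemma normc_real r : normc r%:C = `|r|.
Proof. by rewrite /= expr0n /= addr0 sqrtr_sqr. Qed.

Lemma normc_id r : 0 <= r -> normc r%:C = r.
Proof. by move=> r0; rewrite normc_real ger0_norm. Qed.

Lemma normcX z n : normc (z ^+ n) = normc z ^+ n.
Proof.
elim: n => [|n IH]; first by rewrite !expr0 Normc.normc1.
by rewrite !exprS Normc.normcM IH.
Qed.

Lemma sqr_normcE z : normc z ^+ 2 = complex.Re z ^+ 2 + complex.Im z ^+ 2.
Proof. by case: z => a b /=; rewrite sqr_sqrtr // addr_ge0 ?sqr_ge0. Qed.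

Lemma ler_Re_normc z : `|complex.Re z| <= normc z.
Proof. by rewrite -lecR; exact: normc_ge_Re. Qed.

Lemma nbhs_complexP z (P : set R[i]) :
  nbhs z P <-> exists2 e : R, 0 < e & forall w, normc (w - z) < e -> P w.
Proof.
split.
  move/nbhs_ballP => [e /= e0 H].
  have er : (complex.Re e)%:C = e by rewrite RRe_real // gtr0_real.
  exists (complex.Re e); first by rewrite -ltcR er.
  move=> w hw; apply: H; rewrite -ball_normE /=.
  by rewrite -er -opprB normrN; change ((normc (w - z))%:C < (complex.Re e)%:C); rewrite ltcR.
move=> [e e0 H]; apply/nbhs_ballP; exists e%:C => /=; first by rewrite ltcR.
move=> w; rewrite -ball_normE /= => hw; apply: H.
by rewrite -ltcR normcB; exact: hw.
Qed.

Lemma compact_disc r : compact [set z : R[i] | normc z <= r].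
Proof.
pose sq := `[- r, r]%classic `*` `[- r, r]%classic : set (R * R).
pose f (p : R * R) : R[i] := p.1 +i* p.2.
have cf : continuous f.
  move=> p P /nbhs_complexP [e e0 HP].
  have e2 : 0 < e / 2 by rewrite divr_gt0.
  have H : nbhs p (ball p (e / 2)) by exact: nbhsx_ballx.
  apply: filterS H => q [/=].
  rewrite -!ball_normE /= => h1 h2; apply: HP.
  have -> : f q - f p = (q.1 - p.1)%:C + 'i * (q.2 - p.2)%:C.
    by rewrite /f; apply/eqP; rewrite eq_complex /=; apply/andP; split; apply/eqP; ring.
  apply: le_lt_trans (ler_normcD _ _) _.
  rewrite Normc.normcM !normc_real.
  have -> : normc ('i : R[i]) = 1 by rewrite /= expr0n expr1n /= add0r sqrtr1.
  rewrite mul1r [ltRHS]splitr ltrD // distrC //.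
have cs : compact sq by apply: compact_setX; exact: segment_compact.
apply: subclosed_compact (continuous_compact (continuous_subspaceT cf) cs) _.
  move=> z Hz; rewrite /=; rewrite leNgt; apply/negP => hr.
  have /Hz [w [/= hw]] : nbhs z [set w | normc (w - z) < normc z - r].
    by apply/nbhs_complexP; exists (normc z - r) => //; rewrite subr_gt0.
  apply/negP; rewrite -leNgt.
  have := ler_normcD (z - w) w; rewrite subrK normcB => h.
  by lra.
move=> z /= hz; exists (complex.Re z, complex.Im z); last by case: z hz.
have hi : `|complex.Im z| <= normc z.
  rewrite -(@ler_pXn2r _ 2) ?nnegrE ?normc_ge0 // sqr_normcE real_normK ?num_real //.
  by rewrite lerDr sqr_ge0.
rewrite /sq /=; split; rewrite in_itv /= -ler_norml; apply: le_trans hz => //.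
exact: ler_Re_normc.
Qed.

End ComplexModulus.

Section RealLimits.
Context (R : realType).
Implicit Types (x y k c e : R) (z : R[i]).

(** An additive error that does not grow with t disappears on division by t; this is how terms of
    the size of [alpha] are removed. *)
Lemma le_of_scaled x y k : (forall t, 0 < t -> t * x <= t * y + k) -> x <= y.
Proof.
move=> H; rewrite leNgt; apply/negP => yx.
have k0 : 0 < `|k| + 1 by rewrite ltr_wpDl.
have d0 : 0 < x - y by rewrite subr_gt0.
have := H ((`|k| + 1) / (x - y)) (divr_gt0 k0 d0).
rewrite -lerBlDl -mulrBr divfK ?gt_eqF //.
by have := ler_norm k; lra.
Qed.

Lemma le_of_eps x y c : 0 <= c -> (forall e, 0 < e -> x <= y + c * e) -> x <= y.
Proof.
move=> c0 H; apply/ler_addgt0Pr => e e0.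
have c1 : 0 < c + 1 by rewrite ltr_wpDl.
apply: le_trans (H _ (divr_gt0 e0 c1)) _; rewrite lerD2l.
by rewrite mulrC -mulrA ger_pMr // mulrC ler_pdivrMr // mul1r lerDl.
Qed.

Lemma eq0_of_eps z c : 0 <= c -> (forall e, 0 < e -> normc z <= c * e) -> z = 0.
Proof.
move=> c0 H; apply: Normc.eq0_normc; apply/eqP; rewrite eq_le normc_ge0 andbT.
by apply: (le_of_eps c0) => e e0; rewrite add0r; exact: H.
Qed.

(** Each condition is asked for on a whole interval of small values, so that finitely many of them
    survive taking a minimum. *)
Lemma common_eps (I : eqType) (s : seq I) (P : I -> R -> Prop) :
  (forall i, i \in s -> exists2 e, 0 < e & forall e', 0 < e' <= e -> P i e') ->
  exists2 e, 0 < e & forall i, i \in s -> P i e.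
Proof.
move=> H.
suff [e e0 He] : exists2 e, 0 < e & forall i, i \in s -> forall e', 0 < e' <= e -> P i e'.
  by exists e => // i is_; apply: He; rewrite ?e0 ?lexx.
elim: s H => [|i s IH] H; first by exists 1 => // i; rewrite in_nil.
have [|e e0 He] := IH; first by move=> j js; apply: H; rewrite inE js orbT.
have [|d d0 Hd] := H i; first by rewrite inE eqxx.
exists (Num.min e d); first by rewrite lt_min e0.
move=> j; rewrite inE => /orP[/eqP ->|js] e' /andP[e'0]; rewrite le_min => /andP[h1 h2].
  by apply: Hd; rewrite e'0.
by apply: He => //; rewrite e'0.
Qed.

End RealLimits.

(** * The spectrum in a seminormed algebra is not empty *)

Section Seminorm.
Context (R : realType) (A : comAlgType R[i]) (q : A -> R).
Context (qD : forall x y, q (x + y) <= q x + q y)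
  (qZ : forall (a : R[i]) x, q (a *: x) = normc a * q x)
  (qM : forall x y, q (x * y) <= q x * q y).

Lemma seminorm0 : q 0 = 0.
Proof. by rewrite -(scale0r (0 : A)) qZ Normc.normc0 mul0r. Qed.

Lemma seminormN x : q (- x) = q x.
Proof. by rewrite -scaleN1r qZ normcN Normc.normc1 mul1r. Qed.

Lemma seminorm_ge0 x : 0 <= q x.
Proof. by have := qD x (- x); rewrite subrr seminorm0 seminormN; lra. Qed.

Lemma seminormB x y : q (x - y) <= q x + q y.
Proof. by apply: le_trans (qD _ _) _; rewrite seminormN. Qed.

Lemma seminormX x n : q (x ^+ n.+1) <= q x ^+ n.+1.
Proof.
elim: n => [|n IH]; first by rewrite !expr1.
rewrite exprS [leRHS]exprS; apply: le_trans (qM _ _) _.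
by rewrite ler_wpM2l // seminorm_ge0.
Qed.

End Seminorm.

Section SeminormedAlgebra.
Context (R : realType) (A : comAlgType R[i]) (q : A -> R).
Context (qD : forall x y, q (x + y) <= q x + q y)
  (qZ : forall (a : R[i]) x, q (a *: x) = normc a * q x)
  (qM : forall x y, q (x * y) <= q x * q y)
  (q1_gt0 : 0 < q 1).

Let q0 := seminorm0 qZ.
Let q_ge0 := seminorm_ge0 qD qZ.
Let qB := seminormB qD qZ.

Let q_null m u : q m = 0 -> q (m * u) = 0.
Proof.
by move=> m0; apply/eqP; rewrite eq_le q_ge0 andbT (le_trans (qM _ _)) // m0 mul0r.
Qed.

Let qD_null x m : q m = 0 -> q (x + m) = q x.
Proof.
move=> m0; apply/eqP; rewrite eq_le (le_trans (qD _ _)) ?m0 ?addr0 //=.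
by have := qB (x + m) m; rewrite addrK m0 addr0.
Qed.

Let qX := seminormX qD qZ qM.

Let q1_ge1 : 1 <= q 1.
Proof. by have := qM 1 1; rewrite mulr1 -{1}[q 1]mulr1 ler_pM2l. Qed.

Context (f : A) (h : R[i] -> A)
  (h_inv : forall z, q ((1 - z *: f) * h z - 1) = 0).

(** The mean of h over the points uz with u^(2^k) = 1. The solutions of u^n = -1 are any one of them
    times the n-th roots of unity, so each step doubles the set of points. *)
Fixpoint root_avg (k : nat) (z : R[i]) : A :=
  if k is k'.+1 then
    2^-1 *: (root_avg k' z + root_avg k' ((2 ^ k')%N.-root (-1) * z))
  else h z.

(** With a = (zf)^(2^k), the inductive step is 1/(1 - a^2) = (1/(1 - a) + 1/(1 + a)) / 2, since the
    factor w on z changes a into -a. Equalities hold up to elements of seminorm 0. *)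
Lemma root_avg_inv k z : q ((1 - (z *: f) ^+ (2 ^ k)) * root_avg k z - 1) = 0.
Proof.
elim: k z => [|k IH] z; first by rewrite expn0 expr1.
set w := (2 ^ k)%N.-root (-1) : R[i].
have wE : w ^+ (2 ^ k) = -1 by rewrite rootCK // expn_gt0.
rewrite expnS mulnC exprM /= -/w.
have := IH z; have := IH (w * z).
rewrite -[(w * z) *: f]scalerA exprZn wE scaleN1r opprK.
set a := (z *: f) ^+ _; set F' := root_avg k (w * z); set F := root_avg k z.
move=> h1 h2.
have -> : (1 - a ^+ 2) * (2^-1 *: (F + F')) - 1 =
    ((1 - a) * F - 1) * (2^-1 *: (1 + a)) + ((1 + a) * F' - 1) * (2^-1 *: (1 - a)).
  have [c E] : exists c : A, forall x, 2^-1 *: x = c * x.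
    by exists (2^-1)%:A => x; rewrite mulr_algl.
  have c1 : c * 2 = 1.
    have -> : 2 = 2%:R%:A :> A by rewrite scaler_nat.
    by rewrite -E scalerA mulVf ?pnatr_eq0 // scale1r.
  rewrite !E.
  rewrite -[X in _ - X = _]c1; ring.
by rewrite qD_null ?q_null.
Qed.

Lemma normc_inv2 : normc (2^-1 : R[i]) = 2^-1.
Proof.
by rewrite Normc.normcV -(rmorph_nat (real_complex R)) normc_id.
Qed.

Lemma root_avg_uniform e z z' :
  (forall u, normc u = 1 -> q (h (u * z) - h (u * z')) <= e) ->
  forall k u, normc u = 1 -> q (root_avg k (u * z) - root_avg k (u * z')) <= e.
Proof.
move=> He; elim=> [|k IH] u u1 /=; first exact: He.
set w := (2 ^ k)%N.-root (-1) : R[i].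
have w1 : normc w = 1.
  have : normc (w ^+ (2 ^ k)) = 1 by rewrite rootCK ?expn_gt0 // normcN Normc.normc1.
  rewrite normcX => /eqP; rewrite pexpr_eq1 ?expn_gt0 ?normc_ge0 //.
  by move/eqP.
rewrite -scalerBr qZ normc_inv2 opprD addrACA !(mulrA w).
have wu1 : normc (w * u) = 1 by rewrite Normc.normcM w1 u1 mulr1.
have := qD (root_avg k (u * z) - root_avg k (u * z'))
  (root_avg k (w * u * z) - root_avg k (w * u * z')).
have := IH _ u1; have := IH _ wu1; lra.
Qed.

(** Resolvent identity, up to elements of seminorm 0. *)
Lemma resolvent_lipschitz z z' :
  q (h z - h z') <= normc (z - z') * (q f * (q (h z) * q (h z'))).
Proof.
have -> : h z - h z' = (z - z') *: (f * (h z * h z')) +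
   (((1 - z *: f) * h z - 1) * h z' + ((1 - z' *: f) * h z' - 1) * (- h z)).
  have E t : exists c : A, forall x, t *: x = c * x.
    by exists t%:A => x; rewrite mulr_algl.
  have [c cE] := E z; have [c' c'E] := E z'.
  rewrite scalerBl !cE !c'E; ring.
rewrite qD_null; last by rewrite qD_null ?q_null.
rewrite qZ ler_wpM2l ?normc_ge0 // (le_trans (qM _ _)) // ler_wpM2l //.
Qed.

(** Near z the Lipschitz estimate bounds q (h w) by q (h z) plus half of q (h w), which is absorbed
    on the left; compactness of the disc makes the bound uniform. *)
Lemma resolvent_bounded rho :
  exists2 K, 0 <= K & forall z, normc z <= rho -> q (h z) <= K.
Proof.
have /compact_near_coveringP := @compact_disc R rho.
move=> /(_ R (pinfty_nbhs R) (fun B z => q (h z) <= B) _) [z _|B [Br HB]].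
  pose d := (2 * (q f * q (h z) + 1))^-1.
  have D0 : 0 < 2 * (q f * q (h z) + 1).
    by rewrite mulr_gt0 // ltr_wpDl // mulr_ge0.
  exists ([set w | normc (w - z) < d], [set B | 2 * q (h z) <= B]).
    split => /=; first by apply/nbhs_complexP; exists d => //; rewrite invr_gt0.
    by exists (2 * q (h z)); split; [exact: num_real | move=> B /ltW].
  move=> [w B] /= [hw hB]; apply: le_trans hB.
  have h1 := resolvent_lipschitz w z.
  have h2 : q (h w) <= q (h w - h z) + q (h z) by rewrite -{1}(subrK (h z) (h w)).
  have h3 : normc (w - z) * (q f * (q (h w) * q (h z))) <= 2^-1 * q (h w).
    have -> : normc (w - z) * (q f * (q (h w) * q (h z))) =
      (normc (w - z) * (q f * q (h z))) * q (h w) by ring.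
    rewrite ler_wpM2r //.
    apply: le_trans (_ : d * (q f * q (h z) + 1) <= _).
      by rewrite ler_pM ?normc_ge0 ?mulr_ge0 // ?ltW // ltrDl.
    by rewrite /d invfM -mulrA mulVf ?mulr1 // gt_eqF // ltr_wpDl // mulr_ge0.
  lra.
exists (`|B| + 1) => [|z hz]; first by rewrite addr_ge0.
by apply: (HB (`|B| + 1)) => //; have := ler_norm B; lra.
Qed.

Lemma null_exp_sub1 x n : q (x - 1) = 0 -> q (x ^+ n - 1) = 0.
Proof.
move=> x1; elim: n => [|n IH]; first by rewrite expr0 subrr q0.
have -> : x ^+ n.+1 - 1 = (x ^+ n - 1) + (x - 1) * x ^+ n by rewrite exprS; ring.
by rewrite qD_null ?IH // q_null.
Qed.

Lemma small_two_powers x k e : q (x ^+ (2 ^ k)) < 2^-1 -> 0 < e ->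
  exists l, q (x ^+ (2 ^ l)) <= e.
Proof.
move=> xk e0; set j := Num.bound e^-1; exists (k + j)%N.
rewrite expnD exprM.
have n0 : (0 < 2 ^ j)%N by rewrite expn_gt0.
rewrite -(prednK n0); apply: le_trans (qX _ _) _; rewrite prednK //.
have h1 : q (x ^+ (2 ^ k)) ^+ (2 ^ j) <= 2^-1 ^+ (2 ^ j).
  by rewrite lerXn2r ?nnegrE ?invr_ge0 // ltW.
apply: le_trans h1 _.
apply: le_trans (_ : 2^-1 ^+ j <= _).
  by rewrite ler_wiXn2l ?invr_ge0 ?invf_le1 ?ler1n // ltnW // ltn_expl.
rewrite exprVn invf_ple ?posrE ?exprn_gt0 //.
apply: le_trans (_ : j%:R <= _); first by rewrite ltW // archi_boundP // invr_ge0 ltW.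
by rewrite -natrX ler_nat ltnW // ltn_expl.
Qed.

Context (g : A) (g_inv : q (f * g - 1) = 0).

(* Rickart: [root_avg k z] inverts 1 - (zf)^(2^k) and, being an average of values
   of the resolvent over |u| = |z|, is uniformly continuous in |z|, uniformly in k.
   So the radii r for which some (rf)^(2^k) is small cannot have a supremum. *)
Lemma no_entire_resolvent : False.
Proof.
pose I := [set r : R | 0 <= r /\ exists k, q ((r%:C *: f) ^+ (2 ^ k)) < 2^-1].
have I0 : I 0.
  split=> //; exists 0%N; rewrite scale0r expn0 expr1 q0.
  by rewrite invr_gt0.
(* As g inverts f, q 1 <= q (f^n) (q g)^n; for r > q g this keeps q ((rf)^n) from being small. *)
have Iub r : I r -> r <= q g.
  move=> [r0 [k hk]]; rewrite leNgt; apply/negP => gr.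
  set n := (2 ^ k)%N in hk.
  have n0 : (0 < n)%N by rewrite expn_gt0.
  have rp : 0 < r by apply: le_lt_trans gr.
  have h1 : q 1 <= q (f ^+ n) * q g ^+ n.
    rewrite -(qD_null 1 (null_exp_sub1 n g_inv)) addrC subrK exprMn.
    apply: le_trans (qM _ _) _; rewrite ler_wpM2l //.
    by rewrite -(prednK n0) qX.
  have h2 : r ^+ n * q 1 <= r ^+ n * q (f ^+ n) * q g ^+ n.
    by rewrite -mulrA ler_pM2l ?exprn_gt0.
  have h3 : r ^+ n * q (f ^+ n) < 2^-1.
    by move: hk; rewrite exprZn qZ normcX normc_id.
  have h4 : q g ^+ n <= r ^+ n by rewrite lerXn2r ?nnegrE // ltW.
  have h5 : r ^+ n * q (f ^+ n) * q g ^+ n <= 2^-1 * r ^+ n.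
    by rewrite ler_pM // ?exprn_ge0 // ?mulr_ge0 ?exprn_ge0 // ltW.
  have h6 : 0 < r ^+ n by rewrite exprn_gt0.
  have h7 : r ^+ n <= r ^+ n * q 1 by rewrite ler_peMr // ltW.
  lra.
have supI : has_sup I by split; [exists 0 | exists (q g) => r /Iub].
set r0 := sup I.
have r0_ge0 : 0 <= r0 by apply: ub_le_sup => //; case: supI.
have [K K0 HK] := resolvent_bounded (r0 + 1).
(* With this e, the estimate q b <= 2e (q 1 + q b) reached below for b = (r'f)^(2^l) gives q b <=
   1/3, under the threshold 1/2 of [I]. *)
set e := (8 * q 1)^-1.
have e0 : 0 < e by rewrite invr_gt0 mulr_gt0.
have eq1 : e * q 1 = 8^-1 by rewrite /e invfM -mulrA mulVf ?mulr1 // gt_eqF.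
have e8 : e <= 8^-1.
  by rewrite -eq1 ler_peMr // ltW.
have D1 : 1 <= q f * (K * K) + 1 by rewrite lerDr mulr_ge0 // mulr_ge0.
have D0 : 0 < q f * (K * K) + 1 by apply: lt_le_trans D1.
set d := e / (q f * (K * K) + 1).
have d0 : 0 < d by rewrite divr_gt0.
have dK : d * (q f * (K * K)) <= e.
  rewrite /d -mulrA ger_pMr // mulrC ler_pdivrMr // mul1r.
  by rewrite lerDl.
have d8 : d <= 8^-1 by apply: le_trans e8; rewrite ler_pdivrMr // ler_peMr // ltW.
have [r Ir rlt] := sup_adherent (divr_gt0 d0 (ltr0Sn R 1)) supI.
rewrite -/r0 in rlt.
have rr0 : r <= r0 by apply: ub_le_sup => //; case: supI.
have [rge0 [k0 hk0]] := Ir.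
(* r' exceeds the supremum but is within d of r, so the averages at the two radii differ by at most
   e. *)
pose r' := r0 + d / 2.
have r'lt : r0 < r' by rewrite ltrDl divr_gt0.
have unif u : normc u = 1 -> q (h (u * r%:C) - h (u * r'%:C)) <= e.
  move=> u1; apply: le_trans (resolvent_lipschitz _ _) _.
  rewrite -mulrBr Normc.normcM u1 mul1r -rmorphB normc_real.
  apply: le_trans dK; rewrite ler_pM ?mulr_ge0 //.
    by rewrite ler_norml /r'; apply/andP; split; lra.
  rewrite ler_wpM2l // ler_pM // HK // Normc.normcM u1 mul1r normc_id //; rewrite /r'; lra.
have [l hl] := small_two_powers hk0 (divr_gt0 e0 (mulr_gt0 (ltr0Sn R 1) q1_gt0)).
have u1 : normc (1 : R[i]) = 1 by rewrite Normc.normc1.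
have := root_avg_uniform unif l u1; rewrite !mul1r.
have := root_avg_inv l r%:C; have := root_avg_inv l r'%:C.
set G := root_avg l r%:C; set G' := root_avg l r'%:C.
set b := (r'%:C *: f) ^+ _; move: hl; set a := (r%:C *: f) ^+ _ => ha hb' ha' hG.
have {}ha : q a * (2 * q 1) <= e by rewrite -ler_pdivlMr ?mulr_gt0.
have ha16 : q a <= 16^-1.
  have : q a * 2 <= q a * (2 * q 1) by rewrite mulrA ler_peMr // mulr_ge0.
  by lra.
have haG : q (G - 1) <= q a * q G.
  have -> : G - 1 = a * G + ((1 - a) * G - 1) by ring.
  by rewrite qD_null.
have hqG : q G <= q 1 + q (G - 1).
  by rewrite -{1}(subrK 1 G) addrC qD.
have hqG2 : q a * q G <= 16^-1 * q G by rewrite ler_wpM2r.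
have {}hqG : q G <= 2 * q 1 by have := q_ge0 G; have := q1_gt0; lra.
have hG1 : q (G - 1) <= e.
  by apply: le_trans haG (le_trans _ ha); rewrite ler_wpM2l.
have hG'1 : q (G' - 1) <= 2 * e.
  have -> : G' - 1 = (G - 1) - (G - G') by ring.
  by have := qB (G - 1) (G - G'); lra.
have hb : q b <= (q 1 + q b) * (2 * e).
  have qbE : q b = q ((1 - b) * (G' - 1)).
    have -> : (1 - b) * (G' - 1) = b + ((1 - b) * G' - 1) by ring.
    by rewrite qD_null.
  by rewrite {1}qbE; apply: le_trans (qM _ _) _; rewrite ler_pM // qB.
have : I r'.
  split; first by rewrite ltW // (le_lt_trans r0_ge0).
  exists l; rewrite -/b.
  have : q b * (2 * e) <= q b * 4^-1 by rewrite ler_wpM2l //; lra.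
  by lra.
by move=> Ir'; have : r' <= r0; [apply: ub_le_sup => //; case: supI | rewrite leNgt r'lt].
Qed.

End SeminormedAlgebra.

(** Gelfand-Mazur without quotient algebras: invertibility is tested up to elements of seminorm 0,
    so the theorem can be applied to the norm of A/M viewed on A. *)
Theorem seminormed_spectrum_nonempty (R : realType) (A : comAlgType R[i]) (q : A -> R)
    (qD : forall x y, q (x + y) <= q x + q y)
    (qZ : forall (a : R[i]) x, q (a *: x) = normc a * q x)
    (qM : forall x y, q (x * y) <= q x * q y) (q1_gt0 : 0 < q 1) (f : A) :
  exists z : R[i], forall g, q ((f - z%:A) * g - 1) != 0.
Proof.
apply: contrapT => H.
have {}H z : exists g, q ((f - z%:A) * g - 1) = 0.
  apply: contrapT => Hz; apply: H; exists z => g; apply/negP => /eqP hg.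
  by apply: Hz; exists g.
have [g hg] := choice H.
(* The inverse of 1 - zf, obtained from the inverse [g z^-1] of f - z^-1; at z = 0 the element to
   invert is 1. *)
pose h z := if z == 0 then 1 else - z^-1 *: g z^-1.
have hh z : q ((1 - z *: f) * h z - 1) = 0.
  rewrite /h; case: eqVneq => [->|z0].
    by rewrite scale0r subr0 mul1r subrr -(scale0r (0 : A)) qZ Normc.normc0 mul0r.
  have <- := hg z^-1; congr (q (_ - 1)).
  rewrite -scalerAr scalerAl; congr (_ * _).
  by rewrite scaleNr scalerBr scalerA mulVf // scale1r opprB.
have g0 : q (f * g 0 - 1) = 0 by have := hg 0; rewrite scale0r subr0.
exact: (no_entire_resolvent qD qZ qM q1_gt0 hh g0).
Qed.

(** * Gelfand theory *)

Section Neumann.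
Context (R : realType) (A : comBanachAlgType R).
Implicit Types (f g x y : A) (z : R[i]).

Lemma bnorm_scale z x : bnorm (z *: x) = normc z * bnorm x.
Proof. by apply: (@complexI R); rewrite bnormZ rmorphM. Qed.

Let bnorm0 := seminorm0 bnorm_scale.
Let bnormN := seminormN bnorm_scale.
Lemma bnorm_ge0 x : 0 <= bnorm x.
Proof. exact: (seminorm_ge0 (@bnorm_triangle R A) bnorm_scale). Qed.
Let bnormX := seminormX (@bnorm_triangle R A) bnorm_scale (@bnorm_mul R A).

Lemma geometric_small (t e : R) : 0 <= t < 1 -> 0 < e ->
  exists N, forall n, (N <= n)%N -> t ^+ n < e.
Proof.
move=> /andP[t0 t1] e0.
have := cvg_expr (z := t); rewrite ger0_norm // => /(_ t1) /cvgr0Pnorm_lt /(_ _ e0).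
move=> [N _ HN]; exists N => n Nn; apply: le_lt_trans (HN n Nn).
exact: ler_norm.
Qed.

(** Neumann series. The estimates start at exponent 1: [bnorm 1] may exceed 1, and bnorm (f^n) <=
    (bnorm f)^n is available for n > 0 only. *)
Lemma bnorm_lt1_unit f : bnorm f < 1 -> 1 - f \is a GRing.unit.
Proof.
move=> f1; set t := bnorm f; have t0 : 0 <= t by exact: bnorm_ge0.
have t1 : 0 < 1 - t by rewrite subr_gt0.
have t01 : 0 <= t < 1 by rewrite t0.
pose u n := \sum_(i < n) f ^+ i.
have uE n : (1 - f) * u n = 1 - f ^+ n by rewrite -[RHS]opprB subrX1 -mulNr opprB.
have du n k : bnorm (u (n.+1 + k)%N - u n.+1) <= (t ^+ n.+1 - t ^+ (n.+1 + k)) / (1 - t).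
  elim: k => [|k IH]; first by rewrite addn0 !subrr bnorm0 mul0r.
  rewrite addnS /u big_ord_recr /= addrAC; apply: le_trans (bnorm_triangle _ _) _.
  have -> : (t ^+ n.+1 - t ^+ (n.+1 + k).+1) / (1 - t) =
     (t ^+ n.+1 - t ^+ (n.+1 + k)) / (1 - t) + t ^+ (n.+1 + k).
    by rewrite [t ^+ (_ + _).+1]exprS; field; rewrite gt_eqF.
  by rewrite lerD //; rewrite addSn; exact: bnormX.
have dN N n : (N.+1 <= n)%N -> bnorm (u n - u N.+1) <= t ^+ N.+1 / (1 - t).
  move=> Nn; rewrite -(subnKC Nn); apply: le_trans (du _ _) _.
  by rewrite ler_pM2r ?invr_gt0 // gerBl exprn_ge0.
have [l Hl] : exists l : A, bnorm (u n - l) @[n --> \oo] --> (0 : R).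
  apply: bnorm_complete => e e0.
  have [N HN] := geometric_small t01 (divr_gt0 (mulr_gt0 e0 t1) (ltr0Sn R 1)).
  exists N.+1 => m n Nm Nn.
  have -> : u m - u n = (u m - u N.+1) - (u n - u N.+1) by ring.
  apply: le_lt_trans (bnorm_triangle _ _) _; rewrite bnormN.
  have h : t ^+ N.+1 / (1 - t) < e / 2.
    rewrite ltr_pdivrMr //; apply: lt_le_trans (HN _ (leqnSn N)) _.
    by rewrite mulrAC.
  have := dN _ _ Nm; have := dN _ _ Nn; lra.
apply/unitrPr; exists l; apply/eqP; rewrite -subr_eq0; apply/eqP/bnorm_eq0.
apply/eqP; rewrite eq_le bnorm_ge0 andbT; apply/ler_addgt0Pr => e e0; rewrite add0r.
have [N HN] := geometric_small t01 (divr_gt0 e0 (ltr0Sn R 1)).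
have D0 : 0 < 2 * (bnorm (1 - f) + 1) by rewrite mulr_gt0 // ltr_wpDl // bnorm_ge0.
move: Hl => /cvgr0Pnorm_lt /(_ _ (divr_gt0 e0 D0)) [M _ HM].
pose n := maxn N.+1 M.
have -> : (1 - f) * l - 1 = - ((1 - f) * (u n - l)) - f ^+ n.
  by have := uE n => En; rewrite mulrBr En; ring.
apply: le_trans (bnorm_triangle _ _) _; rewrite !bnormN.
have h1 : bnorm (f ^+ n) <= e / 2.
  have n0 : (0 < n)%N by apply: leq_trans (leq_maxl _ _).
  rewrite -(prednK n0); apply: le_trans (bnormX _ _) _; rewrite (prednK n0) ltW // HN //.
  exact: leq_trans (leqnSn _) (leq_maxl _ _).
have h2 : bnorm ((1 - f) * (u n - l)) <= e / 2.
  apply: le_trans (bnorm_mul _ _) _.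
  have := HM n (leq_maxr _ _); rewrite ger0_norm ?bnorm_ge0 // => h.
  apply: le_trans (_ : (bnorm (1 - f) + 1) * (e / (2 * (bnorm (1 - f) + 1))) <= _).
    by rewrite ler_pM ?bnorm_ge0 // ?lerDl // ltW.
  have : bnorm (1 - f) + 1 != 0 by rewrite gt_eqF // ltr_wpDl // bnorm_ge0.
  by move=> ?; rewrite le_eqVlt; apply/orP; left; apply/eqP; field.
lra.
Qed.

End Neumann.

(** * Characters *)

Section Characters.
Context (R : realType) (A : comBanachAlgType R) (x : A -> R[i]) (xX : characters A x).
Implicit Types (f g : A) (z : R[i]).

Lemma char_linear z f g : x (z *: f + g) = z * x f + x g.
Proof. by case: xX => + _; apply. Qed.

Lemma char1 : x 1 = 1. Proof. by case: xX => _ []. Qed.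

Lemma charM f g : x (f * g) = x f * x g.
Proof. by case: xX => _ [_]; apply. Qed.

Lemma char0 : x 0 = 0.
Proof.
have := char_linear 1 0 0; rewrite scale1r addr0 mul1r => /eqP.
by rewrite -subr_eq subrr eq_sym => /eqP.
Qed.

Lemma charD f g : x (f + g) = x f + x g.
Proof. by rewrite -[f]scale1r char_linear mul1r scale1r. Qed.

Lemma charZ z f : x (z *: f) = z * x f.
Proof. by rewrite -[z *: f]addr0 char_linear char0 addr0. Qed.

Lemma charN f : x (- f) = - x f.
Proof. by rewrite -scaleN1r charZ mulN1r. Qed.

Lemma charB f g : x (f - g) = x f - x g.
Proof. by rewrite charD charN. Qed.

Lemma charX f n : x (f ^+ n) = x f ^+ n.
Proof.
elim: n => [|n IH]; first by rewrite !expr0 char1.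
by rewrite !exprS charM IH.
Qed.

Lemma char_scalar z : x z%:A = z.
Proof. by rewrite charZ char1 mulr1. Qed.

Lemma char_unit f : f \is a GRing.unit -> x f != 0.
Proof.
move=> /mulrV /(congr1 x); rewrite charM char1 => h.
by apply/eqP => f0; move: h => /eqP; rewrite f0 mul0r eq_sym oner_eq0.
Qed.

Lemma charV f : f \is a GRing.unit -> x f^-1 = (x f)^-1.
Proof.
move=> fu; apply: (mulfI (char_unit fu)); rewrite -charM mulrV // char1.
by rewrite mulfV // char_unit.
Qed.

(** Otherwise 1 - f / x(f) would be invertible by the Neumann series, although x vanishes on it. *)
Lemma char_le_bnorm f : normc (x f) <= bnorm f.
Proof.
rewrite leNgt; apply/negP => h.
have n0 : 0 < normc (x f) by apply: le_lt_trans h; exact: bnorm_ge0.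
have xf0 : x f != 0 by rewrite -normc_gt0.
have /char_unit : 1 - (x f)^-1 *: f \is a GRing.unit.
  apply: bnorm_lt1_unit; rewrite bnorm_scale Normc.normcV.
  by rewrite mulrC ltr_pdivrMr // mul1r.
by rewrite charB char1 charZ mulVf // subrr eqxx.
Qed.

Lemma char_kernel_maximal : maximal_ideal (fun f => x f == 0).
Proof.
split.
  split; rewrite ?unfold_in /= ?char0 ?eqxx // ?char1 ?oner_eq0 //.
  move=> a f g; rewrite !unfold_in => /eqP f0 /eqP g0.
  by rewrite charD charM f0 g0 mulr0 addr0.
move=> I [I0 I1 IM] kI f fI; rewrite unfold_in; apply/negPn/negP => xf0.
move/negP: I1; apply.
have k : 1 - (x f)^-1%:A * f \in I.
  by apply: kI; rewrite unfold_in charB char1 charM char_scalar mulVf // subrr.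
by have := IM ((x f)^-1%:A) f _ fI k; rewrite addrC subrK.
Qed.

End Characters.

(** * Maximal ideals are kernels of characters *)

Section MaximalIdeals.
Context (R : realType) (A : comBanachAlgType R).
Implicit Types (f g x y : A) (z : R[i]).

Section QuotientNorm.
Context (M : {pred A}) (M_ideal : idealr_closed M).

Let M0 : 0 \in M. Proof. by case: M_ideal. Qed.
Let MD f g : f \in M -> g \in M -> f + g \in M.
Proof. by case: M_ideal => _ _ h fM gM; rewrite -[f]mul1r h. Qed.
Let MM f g : g \in M -> f * g \in M.
Proof. by case: M_ideal => _ _ h gM; rewrite -[f * g]addr0 h. Qed.

(** The norm of A/M as a seminorm on A; it makes sense before M is known to be closed. *)
Definition quotient_norm x := inf [set bnorm (x + m) | m in [set m | m \in M]].
Local Notation q := quotient_norm.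

Let has_infq x : has_inf [set bnorm (x + m) | m in [set m | m \in M]].
Proof.
split; first by exists (bnorm (x + 0)); exists 0.
by exists 0 => _ [m _ <-]; exact: bnorm_ge0.
Qed.

Lemma quotient_norm_le x m : m \in M -> q x <= bnorm (x + m).
Proof. by move=> mM; apply: ge_inf; [case: (has_infq x) | exists m]. Qed.

Lemma quotient_norm_approx x e : 0 < e -> exists2 m, m \in M & bnorm (x + m) < q x + e.
Proof. by move=> e0; have [_ [m mM <-] h] := inf_adherent e0 (has_infq x); exists m. Qed.

Lemma quotient_norm_ge0 x : 0 <= q x.
Proof.
apply: lb_le_inf; first by case: (has_infq x).
by move=> _ [m _ <-]; exact: bnorm_ge0.
Qed.

Lemma quotient_normD x y : q (x + y) <= q x + q y.
Proof.
apply/ler_addgt0Pr => e e0; have e2 : 0 < e / 2 by rewrite divr_gt0.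
have [m mM hm] := quotient_norm_approx x e2; have [n nM hn] := quotient_norm_approx y e2.
have := quotient_norm_le (x + y) (MD mM nM); rewrite addrACA.
by have := bnorm_triangle (x + m) (y + n); lra.
Qed.

Let qZ_le z x : q (z *: x) <= normc z * q x.
Proof.
apply/ler_addgt0Pr => e e0.
have n0 : 0 < normc z + 1 by rewrite ltr_wpDl // normc_ge0.
have [m mM hm] := quotient_norm_approx x (divr_gt0 e0 n0).
have zm : z *: m \in M by rewrite -mulr_algl MM.
apply: le_trans (quotient_norm_le _ zm) _; rewrite -scalerDr bnorm_scale.
apply: le_trans (_ : normc z * (q x + e / (normc z + 1)) <= _).
  by rewrite ler_wpM2l ?normc_ge0 // ltW.
rewrite mulrDr lerD2l mulrC -mulrA ger_pMr // mulrC ler_pdivrMr // mul1r.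
by rewrite lerDl.
Qed.

Lemma quotient_normZ z x : q (z *: x) = normc z * q x.
Proof.
apply/eqP; rewrite eq_le qZ_le /=.
have [->|z0] := eqVneq z 0.
  by rewrite Normc.normc0 mul0r quotient_norm_ge0.
rewrite -ler_pdivlMl ?normc_gt0 // -Normc.normcV.
by have := qZ_le z^-1 (z *: x); rewrite scalerA mulVf // scale1r.
Qed.

Lemma quotient_normM x y : q (x * y) <= q x * q y.
Proof.
apply/ler_addgt0Pr => d d0.
have := quotient_norm_ge0 x; have := quotient_norm_ge0 y => qy qx.
pose e := Num.min 1 (d / (q x + q y + 1)).
have D0 : 0 < q x + q y + 1 by rewrite ltr_wpDl // addr_ge0.
have e0 : 0 < e by rewrite lt_min ltr01 divr_gt0.
have e1 : e <= 1 by rewrite ge_min lexx.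
have ed : e * (q x + q y + 1) <= d by rewrite -ler_pdivlMr // ge_min lexx orbT.
have [m mM hm] := quotient_norm_approx x e0; have [n nM hn] := quotient_norm_approx y e0.
have kM : x * n + (y * m + m * n) \in M by rewrite !MD // MM.
apply: le_trans (quotient_norm_le _ kM) _.
have -> : x * y + (x * n + (y * m + m * n)) = (x + m) * (y + n) by ring.
apply: le_trans (bnorm_mul _ _) _.
apply: le_trans (_ : (q x + e) * (q y + e) <= _).
  by rewrite ler_pM ?bnorm_ge0 // ltW.
have : e * e <= e * 1 by rewrite ler_pM2l.
lra.
Qed.

(** An element of M at distance less than 1 from 1 would be invertible. *)
Lemma quotient_norm1 : 1 <= q 1.
Proof.
apply: lb_le_inf; first by case: (has_infq 1).
move=> _ [m mM <-]; rewrite leNgt; apply/negP => /bnorm_lt1_unit.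
rewrite opprD addNKr => mu; case: M_ideal => _ /negP M1 _; apply: M1.
rewrite -(mulVr mu) mulrN -mulNr; exact: MM.
Qed.

End QuotientNorm.

(** By Gelfand-Mazur some f - z has no inverse modulo M in the seminorm, so M and f - z generate a
    proper ideal, which is M by maximality. The character sends f to this unique z. *)
Lemma maximal_ideal_character (M : {pred A}) : maximal_ideal M ->
  exists2 x : A -> R[i], characters A x & forall f, (f \in M) = (x f == 0).
Proof.
move=> [Mi Mmax]; have [M0 M1 MDM] := Mi.
have MM f g : g \in M -> f * g \in M by move=> gM; rewrite -[f * g]addr0 MDM.
have MD f g : f \in M -> g \in M -> f + g \in M by move=> fM gM; rewrite -[f]mul1r MDM.
have val f : exists z, f - z%:A \in M.
  have q1 : 0 < quotient_norm M 1 by apply: lt_le_trans (quotient_norm1 Mi).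
  have [z hz] := seminormed_spectrum_nonempty (quotient_normD Mi) (quotient_normZ Mi)
    (quotient_normM Mi) q1 f.
  exists z; pose I : {pred A} := fun g => `[< exists m h, m \in M /\ g = m + (f - z%:A) * h >].
  have IP g : g \in I <-> exists m h, m \in M /\ g = m + (f - z%:A) * h.
    by rewrite unfold_in; split => /asboolP.
  have II : idealr_closed I.
    split.
    - by apply/IP; exists 0, 0; rewrite M0 mulr0 addr0.
    - apply/negP => /IP [m [h [mM E]]]; have /eqP := hz h; apply.
      apply/eqP; rewrite eq_le quotient_norm_ge0 // andbT.
      apply: le_trans (quotient_norm_le Mi _ mM) _.
      have -> : (f - z%:A) * h - 1 + m = m + (f - z%:A) * h - 1 by ring.
      by rewrite -E subrr (seminorm0 (@bnorm_scale R A)).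
    - move=> a u v /IP [m [h [mM ->]]] /IP [m' [h' [mM' ->]]]; apply/IP.
      exists (a * m + m'), (a * h + h'); split; first exact: MDM.
      by ring.
  apply: (Mmax I) => //.
    by move=> m mM; apply/IP; exists m, 0; rewrite mulr0 addr0.
  by apply/IP; exists 0, 1; rewrite M0 add0r mulr1.
have uniq_val z z' f : f - z%:A \in M -> f - z'%:A \in M -> z = z'.
  move=> h h'; apply/eqP/negPn/negP => zz'; move/negP: M1; apply.
  have d0 : z' - z != 0 by rewrite subr_eq0 eq_sym.
  have -> : 1 = (z' - z)^-1%:A * ((-1) * (f - z'%:A) + (f - z%:A)) :> A.
    have -> : (-1) * (f - z'%:A) + (f - z%:A) = (z' - z)%:A.
      by rewrite scalerBl; ring.
    by rewrite mulr_algl scalerA mulVf // scale1r.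
  by rewrite MM // MDM.
have [x hx] := choice val.
have xE f z : f - z%:A \in M -> x f = z by move=> h; apply: uniq_val (hx f) h.
exists x; last first.
  move=> f; apply/idP/eqP => [fM|f0]; first by apply: xE; rewrite scale0r subr0.
  by have := hx f; rewrite f0 scale0r subr0.
split.
  move=> a f g; apply: xE.
  have -> : a *: f + g - (a * x f + x g)%:A = a%:A * (f - (x f)%:A) + (g - (x g)%:A).
    by rewrite scalerDl -scalerA mulr_algl scalerBr; ring.
  by rewrite MDM.
split; first by apply: xE; rewrite scale1r subrr.
move=> f g; apply: xE.
have -> : f * g - (x f * x g)%:A = f * (g - (x g)%:A) + (x g)%:A * (f - (x f)%:A).
  have -> : (x f * x g)%:A = (x g)%:A * (x f)%:A :> A.
    by rewrite mulr_algl scalerA mulrC.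
  by ring.
by rewrite MD // MM.
Qed.

Lemma nonunit_maximal_ideal f : f \isn't a GRing.unit ->
  exists2 M : {pred A}, maximal_ideal M & f \in M.
Proof.
move=> fN.
pose ideal (I : set A) := [/\ I 0, ~ I 1 & forall a u v, I u -> I v -> I (a * u + v)].
pose P : set (set A) := [set I | I = set0 \/ (ideal I /\ I f)].
have [I [PI maxI]] : exists I, P I /\ forall J, I `<` J -> ~ P J.
  apply: Zorn_bigcup => F FP Ftot.
  have [F0|] := pselect (forall I, F I -> I = set0).
    by left; apply/seteqP; split => // u [J FJ]; rewrite (F0 J FJ).
  move=> /existsNP [J0 /not_implyP [FJ0 J0n]]; right.
  have [//|[[J00 J01 J0M] J0f]] := FP _ FJ0.
  split; last by exists J0.
  split; first by exists J0.
    by move=> [J FJ J1]; have [J0'|[[_ + _] _]] := FP _ FJ; [rewrite J0' in J1 | apply].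
  move=> a u v [J FJ Ju] [K FK Kv].
  have idJ : ideal J by have [J0'|[]] := FP _ FJ; [rewrite J0' in Ju | ].
  have idK : ideal K by have [K0'|[]] := FP _ FK; [rewrite K0' in Kv | ].
  have [JK|KJ] := Ftot _ _ FJ FK.
    by exists K => //; case: idK => _ _; apply => //; exact: JK.
  by exists J => //; case: idJ => _ _; apply => //; exact: KJ.
have Pf : P [set u | exists h, u = f * h].
  right; split; last by exists 1; rewrite mulr1.
  split; first by exists 0; rewrite mulr0.
    by move=> [h /esym fh]; move/negP: fN; apply; apply/unitrPr; exists h.
  by move=> a u v [h ->] [k ->]; exists (a * h + k); ring.
have {PI} [I0|[[I0 I1 IM] If]] := PI.
  exfalso; apply: (maxI [set u | exists h, u = f * h]) => //; rewrite I0.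
  by split=> // H; apply: (H 0); exists 0; rewrite mulr0.
exists (fun u => `[< I u >]); last by rewrite unfold_in; apply/asboolP.
split.
  split; rewrite ?unfold_in; [exact/asboolP|exact/asboolPn|].
  by move=> a u v; rewrite !unfold_in => /asboolP Iu /asboolP Iv; apply/asboolP/IM.
move=> J [J0 J1 JM] IJ u uJ; rewrite unfold_in; apply/asboolP; apply: contrapT => uI.
apply: (maxI [set u | u \in J]); last first.
  right; split; last by apply: IJ; rewrite unfold_in; apply/asboolP.
  by split => //; exact/negP.
split=> [v Iv|h]; last by apply: uI; exact: (h _ uJ).
by apply: IJ; rewrite unfold_in; apply/asboolP.
Qed.

Lemma unit_charP f : f \is a GRing.unit <-> (forall x : A -> R[i], characters A x -> x f != 0).
Proof.
split=> [fu x xX|H]; first exact: char_unit.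
apply/negPn/negP => /nonunit_maximal_ideal [M /maximal_ideal_character [x xX xM]].
by rewrite xM; apply/negP/H.
Qed.

Lemma spectrumP f z : spectrum f z <-> exists2 x : A -> R[i], characters A x & x f = z.
Proof.
split=> [fz|[x xX <-]].
  have [M /maximal_ideal_character [x xX xM]] := nonunit_maximal_ideal fz.
  by rewrite xM charB // char_scalar // subr_eq0 => /eqP; exists x.
by apply/negP => /char_unit; move=> /(_ x xX); rewrite charB // char_scalar // subrr eqxx.
Qed.

Lemma semisimple_gelfand0 f : semisimple A ->
  (forall x : A -> R[i], characters A x -> x f = 0) -> f = 0.
Proof.
move=> ss H; apply: ss => M /maximal_ideal_character [x xX xM].
by rewrite xM H.
Qed.

Lemma gelfand0_semisimple :
  (forall f, (forall x : A -> R[i], characters A x -> x f = 0) -> f = 0) -> semisimple A.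
Proof.
move=> H f fM; apply: H => x xX; apply/eqP.
exact: (fM _ (char_kernel_maximal xX)).
Qed.

End MaximalIdeals.

Lemma ler_dist_normc (R : realType) (z w : R[i]) : `|normc z - normc w| <= normc (z - w).
Proof.
have h1 := ler_normcD (z - w) w; have h2 := ler_normcD (w - z) z.
rewrite subrK in h1; rewrite subrK normcB in h2.
by rewrite ler_norml; apply/andP; split; lra.
Qed.

(** * The space of characters and its minimal closed boundary *)

Section CharacterSpace.
Context (R : realType) (A : comBanachAlgType R).
Implicit Types (f g : A) (x y : {ptws A -> R[i]}) (hs : seq A).

Definition ptws_nbhd x hs (e : R) : set {ptws A -> R[i]} :=
  [set y | forall h, h \in hs -> normc (y h - x h) < e].

Lemma nbhs_ptws_nbhd x hs e : 0 < e -> nbhs x (ptws_nbhd x hs e).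
Proof.
move=> e0; elim: hs => [|h hs IH].
  by apply: filterS filterT => y _ g; rewrite in_nil.
have hx : nbhs x [set y | normc (y h - x h) < e].
  apply: (@proj_continuous A (fun=> R[i]) h x [set z | normc (z - x h) < e]).
  by apply/nbhs_complexP; exists e.
apply: filterS (@filterI _ (nbhs x) _ _ _ hx IH) => y [/= yh yhs] g.
by rewrite inE => /orP [/eqP -> //|]; exact: yhs.
Qed.

Lemma open_ptws_nbhd x hs e : open (ptws_nbhd x hs e).
Proof.
rewrite openE => y yV.
have [d d0 Hd] : exists2 d, 0 < d & forall h, h \in hs -> normc (y h - x h) + d <= e.
  elim: hs yV => [|h hs IH] yV; first by exists 1 => // h; rewrite in_nil.
  have [|d d0 Hd] := IH; first by move=> g gs; apply: yV; rewrite inE gs orbT.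
  have hh : normc (y h - x h) < e by apply: yV; rewrite inE eqxx.
  exists (Num.min d (e - normc (y h - x h))); first by rewrite lt_min d0 subr_gt0.
  move=> g; rewrite inE => /orP [/eqP ->|gs].
    by rewrite addrC -lerBrDr ge_min lexx orbT.
  by apply: le_trans (Hd g gs); rewrite lerD2l ge_min lexx.
apply: filterS (nbhs_ptws_nbhd y hs d0) => z zy h hhs.
apply: lt_le_trans (Hd h hhs).
have -> : z h - x h = (y h - x h) + (z h - y h) by ring.
by apply: le_lt_trans (ler_normcD _ _) _; rewrite ltrD2l zy.
Qed.

Lemma normc_eval_continuous f : continuous (fun y : {ptws A -> R[i]} => normc (y f)).
Proof.
move=> x P /nbhs_ballP [e /= e0 HP].
apply: filterS (nbhs_ptws_nbhd x [:: f] e0) => y /(_ f); rewrite inE eqxx => /(_ isT) h.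
apply: HP; rewrite -ball_normE /=.
by apply: le_lt_trans (ler_dist_normc _ _) _; rewrite normcB.
Qed.

(** A closed subset of the product of the discs of radius [bnorm f]. Each algebraic identity
    involves finitely many coordinates, on which a limit point is approximated by a character. *)
Lemma compact_characters : compact (characters A).
Proof.
pose D := [set x : {ptws A -> R[i]} | forall f, [set z | normc z <= bnorm f] (x f)].
have cD : compact D.
  by apply: (@tychonoff A (fun=> R[i]) (fun f => [set z | normc z <= bnorm f])) => f; exact: compact_disc.
apply: subclosed_compact cD _; last by move=> x xX f; exact: char_le_bnorm.
move=> x xcl.
have approx hs e : 0 < e -> exists2 y : {ptws A -> R[i]}, characters A y & ptws_nbhd x hs e y.
  by move=> e0; have [y [yX yV]] := xcl _ (nbhs_ptws_nbhd x hs e0); exists y.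
split; [move=> a f g | split; [|move=> f g]].
- apply/eqP; rewrite -subr_eq0; apply/eqP; apply: (@eq0_of_eps _ _ (normc a + 2)) => [|e e0].
    by rewrite addr_ge0 ?normc_ge0.
  have [y yX yV] := approx [:: a *: f + g; f; g] e e0.
  have -> : x (a *: f + g) - (a * x f + x g) =
     a * (y f - x f) + ((y g - x g) - (y (a *: f + g) - x (a *: f + g))).
    by rewrite (char_linear yX); ring.
  have h1 := yV (a *: f + g); have h2 := yV f; have h3 := yV g.
  rewrite !inE !eqxx ?orbT in h1 h2 h3.
  apply: le_trans (ler_normcD _ _) _; rewrite Normc.normcM mulrDl.
  have := ler_normcD (y g - x g) (- (y (a *: f + g) - x (a *: f + g))).
  rewrite normcN => h4; have := h1 isT; have := h3 isT.
  have : normc a * normc (y f - x f) <= normc a * e by rewrite ler_wpM2l ?normc_ge0 // ltW // h2.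
  by lra.
- apply/eqP; rewrite -subr_eq0; apply/eqP; apply: (@eq0_of_eps _ _ 1) => // e e0.
  have [y yX yV] := approx [:: 1] e e0.
  by rewrite mul1r normcB -(char1 yX) ltW // yV // inE.
- apply/eqP; rewrite -subr_eq0; apply/eqP; apply: (@eq0_of_eps _ _ (bnorm f + normc (x g) + 1)) => [|e e0].
    by rewrite !addr_ge0 ?normc_ge0 // bnorm_ge0.
  have [y yX yV] := approx [:: f * g; f; g] e e0.
  have -> : x (f * g) - x f * x g = y f * (y g - x g) + (y f - x f) * x g -
     (y (f * g) - x (f * g)).
    by rewrite (charM yX); ring.
  have h1 := yV (f * g); have h2 := yV f; have h3 := yV g.
  rewrite !inE !eqxx ?orbT in h1 h2 h3.
  apply: le_trans (ler_normcD _ _) _; rewrite normcN.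
  have := ler_normcD (y f * (y g - x g)) ((y f - x f) * x g); rewrite !Normc.normcM => h4.
  have h5 : normc (y f) * normc (y g - x g) <= bnorm f * e.
    by rewrite ler_pM ?normc_ge0 // ?char_le_bnorm // ltW // h3.
  have h6 : normc (y f - x f) * normc (x g) <= e * normc (x g).
    by rewrite ler_wpM2r ?normc_ge0 // ltW // h2.
  have := h1 isT; lra.
Qed.

Lemma characters_neq0 : characters A !=set0.
Proof.
have /nonunit_maximal_ideal [M /maximal_ideal_character [x xX _] _] : (0 : A) \isn't a GRing.unit.
  by rewrite unitr0.
by exists x.
Qed.

Lemma normc_char_le x f : characters A x -> normc (x f) <= spectral_radius f.
Proof.
move=> xX; apply: ub_le_sup; last by exists (x f) => //; apply/spectrumP; exists x.
by exists (bnorm f) => _ [_ /spectrumP [y yX <-] <-]; exact: char_le_bnorm.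
Qed.

Lemma spectral_radius_le f (r : R) :
  (forall x, characters A x -> normc (x f) <= r) -> spectral_radius f <= r.
Proof.
move=> H; apply: ge_sup.
  have [x xX] := characters_neq0; exists (normc (x f)); exists (x f) => //.
  by apply/spectrumP; exists x.
by move=> _ [_ /spectrumP [x xX <-] <-]; exact: H.
Qed.

Lemma peripheral_spectrumP f z : peripheral_spectrum f z <->
  (exists2 x : {ptws A -> R[i]}, characters A x & x f = z) /\ normc z = spectral_radius f.
Proof.
rewrite /peripheral_spectrum /=; split => [[/spectrumP fz [zr]]|[fz zr]]; split => //.
  exact/spectrumP.
by congr (_%:C).
Qed.

Lemma max_on_compact (K : set {ptws A -> R[i]}) f : compact K -> K !=set0 ->
  exists2 y, K y & forall x, K x -> normc (x f) <= normc (y f).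
Proof.
move=> cK K0.
have [y yK H] := compact_EVT_max K0 cK
  (continuous_subspaceT (@normc_eval_continuous f)).
exists y; first exact: set_mem.
by move=> x xK; apply: H; apply: mem_set.
Qed.

Lemma spectral_radius_attained f :
  exists2 y, characters A y & normc (y f) = spectral_radius f.
Proof.
have [y yX H] := max_on_compact f compact_characters characters_neq0.
exists y => //; apply/eqP; rewrite eq_le normc_char_le //.
exact: spectral_radius_le.
Qed.

Definition boundary (G : set {ptws A -> R[i]}) : Prop :=
  G `<=` characters A /\
  forall f, exists2 y, G y & normc (y f) = spectral_radius f.

Lemma closed_characters_setD (U : set {ptws A -> R[i]}) :
  open U -> compact (characters A `\` U).
Proof.
move=> oU; rewrite setDE; apply: compact_closedI; first exact: compact_characters.
exact: open_closedC.
Qed.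

(** Existence of the Shilov boundary. Zorn's lemma is applied to the open complements, so that
    chains are bounded by unions. *)
Lemma minimal_boundary : exists2 U : set {ptws A -> R[i]},
  open U /\ boundary (characters A `\` U) &
  forall V, open V -> U `<` V -> ~ boundary (characters A `\` V).
Proof.
pose P := [set U : set {ptws A -> R[i]} | open U /\ boundary (characters A `\` U)].
have [|U [[oU bU] Umax]] := @Zorn_bigcup _ P; last first.
  by exists U => // V oV UV bV; apply: (Umax V UV).
move=> F FP Ftot; split.
  by apply: bigcup_open => U /FP [].
split; first by move=> x [].
move=> f; apply: contrapT => Hf.
pose K := [set y | characters A y /\ normc (y f) = spectral_radius f].
have KF y : K y -> exists2 U, F U & U y.
  move=> [yX yf]; apply: contrapT => nU; apply: Hf; by exists y.
have [y0 y0X y0f] := spectral_radius_attained f.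
have [U0 FU0 _] := KF y0 (conj y0X y0f).
(* The parts of the maximum set of |f| outside the members of the chain are nonempty and nested. A
   cluster point of them is again a maximum point, hence lies in some open member, and this member
   is disjoint from one of the parts. *)
pose G := filter_from F (fun U => K `\` U).
have GF : Filter G.
  apply: filter_from_filter; first by exists U0.
  move=> U V FU FV; have [UV|VU] := Ftot _ _ FU FV.
    by exists V => // y [yK yV]; split; split=> // /UV.
  by exists U => // y [yK yU]; split; split=> // /VU.
have GP : ProperFilter G.
  apply: filter_from_proper => U /FP [_ [_ /(_ f) [y [yX yU] yf]]].
  by exists y.
have GX : G (characters A) by exists U0 => // y [[]].
have [y [yX yG]] := compact_characters GP GX.
have yK : K y.
  split=> //; apply/eqP; rewrite eq_le normc_char_le //=.
  apply/ler_addgt0Pr => e e0.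
  have GK : G K by exists U0 => // z [].
  have [z [[zX zf] /(_ f)]] := yG _ _ GK (nbhs_ptws_nbhd y [:: f] e0).
  rewrite inE eqxx => /(_ isT) h.
  by rewrite -zf; have := ler_normcD (z f - y f) (y f); rewrite subrK; lra.
have [U FU Uy] := KF y yK.
have [z [[_ zU] Uz]] : (K `\` U) `&` U !=set0.
  apply: (yG (K `\` U) U); first by exists U.
  by apply: open_nbhs_nbhs; split=> //; case: (FP _ FU).
exact: zU.
Qed.

End CharacterSpace.

(** * Peaking boundaries *)

Section PeakingBoundary.
Context (R : realType) (A : comBanachAlgType R).
Implicit Types (f g : A) (x y : {ptws A -> R[i]}) (hs : seq A).

(** The value 1 is taken at some y1 of G near y0, not at y0 itself, because a point of the minimal
    boundary need not be a peak point. The bound q off the neighbourhood is asked on G only. *)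
Definition peaking (G : set {ptws A -> R[i]}) : Prop :=
  forall y0 hs (e : R), G y0 -> 0 < e -> exists f y1 (q : R),
    [/\ G y1 /\ ptws_nbhd y0 hs e y1, y1 f = 1,
        forall x, characters A x -> normc (x f) <= 1, 0 <= q < 1
      & forall y, G y -> normc (y f) <= q \/ ptws_nbhd y0 hs e y].

(** By minimality the points outside V no longer form a boundary, so some f attains its maximum
    modulus on G inside V only; it is divided by one of its maximal values. *)
Lemma exists_peaking_boundary : exists G, boundary G /\ peaking G.
Proof.
have [U [oU bU] Umax] := minimal_boundary A.
exists (characters A `\` U); split => // y0 hs e [y0X y0U] e0.
set V := ptws_nbhd y0 hs e.
have oV : open V by exact: open_ptws_nbhd.
have Vy0 : V y0 by move=> h _; rewrite subrr Normc.normc0.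
have oUV : open (U `|` V) by exact: openU.
have cK := closed_characters_setD oUV.
have [K0|] := pselect (characters A `\` (U `|` V) !=set0); last first.
  move=> K0; exists 1, y0, 0; split => //.
  - by rewrite char1.
  - by move=> x xX; rewrite char1 // Normc.normc1.
  - by rewrite lexx ltr01.
  move=> y [yX yU]; right; apply: contrapT => yV; apply: K0; exists y; split => // -[//|//].
have UV : U `<` U `|` V.
  by split=> [x Ux|/(_ y0)]; [left | move=> h; apply: y0U; apply: h; right].
have := Umax _ oUV UV; rewrite /boundary => /not_andP [|]; first by case; move=> x [].
move=> /existsNP [f Hf].
have [y2 [y2X y2UV] y2max] := max_on_compact f cK K0.
have y2lt : normc (y2 f) < spectral_radius f.
  rewrite lt_neqAle normc_char_le // andbT; apply/eqP => E.
  by apply: Hf; exists y2.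
have r0 : 0 < spectral_radius f by apply: le_lt_trans y2lt; exact: normc_ge0.
have [_ /(_ f) [y1 [y1X y1U] y1f]] := bU.
have y1V : V y1.
  apply: contrapT => y1V; apply: Hf; exists y1 => //; split=> // -[//|//].
have y1n0 : y1 f != 0 by rewrite -normc_gt0 y1f.
exists ((y1 f)^-1 *: f), y1, (normc (y2 f) / spectral_radius f); split => //.
- by rewrite charZ // mulVf.
- move=> x xX; rewrite charZ // Normc.normcM Normc.normcV y1f.
  by rewrite mulrC ler_pdivrMr // mul1r normc_char_le.
- by rewrite divr_ge0 ?normc_ge0 ?(ltW r0) //= ltr_pdivrMr // mul1r.
move=> y [yX yU]; have [yV|yV] := pselect (V y); [by right | left].
rewrite charZ // Normc.normcM Normc.normcV y1f mulrC ler_pM2r ?invr_gt0 //.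
by apply: y2max; split=> // -[//|//].
Qed.

Context (G : set {ptws A -> R[i]}) (bG : boundary G).

Lemma boundary_char y : G y -> characters A y.
Proof. by case: bG => + _; apply. Qed.

Lemma normc_add1_eq2 (w : R[i]) : normc w <= 1 -> normc (w + 1) = 2 -> w = 1.
Proof.
move=> w1 w2.
have h2 : normc w ^+ 2 <= 1 by rewrite expr_le1 // normc_ge0.
have h3 : normc (w + 1) ^+ 2 = 4 by rewrite w2; ring.
rewrite !sqr_normcE in h2 h3; case: w h2 h3 {w1 w2} => a b /= h2 h3.
rewrite addr0 in h3.
have a1 : a = 1.
  have := sqr_ge0 b; have := sqr_ge0 (a - 1); nra.
have b0 : b = 0.
  rewrite a1 in h2; apply/eqP; rewrite -sqrf_eq0 eq_le sqr_ge0 andbT; lra.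
by rewrite a1 b0.
Qed.

(* A peripheral value z of f is where |f / z + 1| attains its maximum 2. *)
Lemma boundary_peripheral f z : peripheral_spectrum f z ->
  exists2 y, G y & y f = z.
Proof.
move=> /peripheral_spectrumP [[x xX xf] zr].
have [_ att] := bG.
have [z0|z0] := eqVneq z 0.
  have [y Gy yf] := att f; exists y => //.
  by rewrite z0; apply: Normc.eq0_normc; rewrite yf -zr z0 Normc.normc0.
have r0 : 0 < spectral_radius f by rewrite -zr normc_gt0.
have le1 t : characters A t -> normc (z^-1 * t f) <= 1.
  move=> tX; rewrite Normc.normcM Normc.normcV zr mulrC ler_pdivrMr // mul1r.
  exact: normc_char_le.
pose k := z^-1 *: f + 1.
have kE t : characters A t -> t k = z^-1 * t f + 1 by move=> tX; rewrite charD // charZ // char1.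
have kr : spectral_radius k = 2.
  apply/eqP; rewrite eq_le; apply/andP; split.
    apply: spectral_radius_le => t tX; rewrite kE //.
    by have := ler_normcD (z^-1 * t f) 1; rewrite Normc.normc1; have := le1 t tX; lra.
  have -> : 2 = normc (x k).
    by rewrite kE // xf mulVf // -[1 + 1](rmorph_nat (real_complex R) 2) normc_id.
  exact: normc_char_le.
have [y Gy yk] := att k; exists y => //.
have yX := boundary_char Gy.
have : z^-1 * y f = 1 by apply: normc_add1_eq2; rewrite ?le1 // -kE // yk kr.
by move/(congr1 ( *%R z)); rewrite mulrA mulfV // mul1r mulr1.
Qed.

Context (pG : peaking G).

Lemma exp_small (q e : R) : 0 <= q < 1 -> 0 < e -> exists n, q ^+ n <= e.
Proof.
by move=> q01 e0; have [N HN] := geometric_small q01 e0; exists N; rewrite ltW // HN.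
Qed.

(** With u = Re b, 9 |1 - w|^2 = |1 - b|^2 |3 + b|^2 <= 32 (1 - u), whereas 9 |w|^2 = |b|^2 |2 +
    b|^2 <= 5 + 4u gives 9 (1 - |w|^2) >= 4 (1 - u). The ratio of the two bounds is the constant
    8. *)
Lemma peaking_disc (b w : R[i]) : normc b <= 1 -> w = b * (2 + b) / 3 ->
  normc w <= normc b /\ normc (1 - w) ^+ 2 <= 8 * (1 - normc w ^+ 2).
Proof.
move=> b1 wE.
have n3 : normc (3 : R[i]) = 3 by rewrite -(rmorph_nat (real_complex R) 3) normc_id.
have n2 : normc (2 : R[i]) = 2 by rewrite -(rmorph_nat (real_complex R) 2) normc_id.
have w2 : 9 * normc w ^+ 2 = normc b ^+ 2 * normc (2 + b) ^+ 2.
  by rewrite wE !Normc.normcM Normc.normcV n3; field.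
have v2 : 9 * normc (1 - w) ^+ 2 = normc (1 - b) ^+ 2 * normc (3 + b) ^+ 2.
  have -> : 1 - w = (1 - b) * (3 + b) / 3 by rewrite wE; field.
  by rewrite !Normc.normcM Normc.normcV n3; field.
have N1 : normc b ^+ 2 <= 1 by rewrite expr_le1 // normc_ge0.
split.
  rewrite wE !Normc.normcM Normc.normcV n3 -mulrA ler_piMr ?normc_ge0 //.
  by rewrite ler_pdivrMr // mul1r; have := ler_normcD 2 b; rewrite n2; lra.
have E k : normc (k%:R + b) ^+ 2 = k%:R ^+ 2 + 2 * k%:R * complex.Re b + normc b ^+ 2.
  rewrite -(rmorph_nat (real_complex R) k) !sqr_normcE.
  by case: b {b1 wE w2 v2 N1} => u v /=; ring.
have E1 : normc (1 - b) ^+ 2 = 1 - 2 * complex.Re b + normc b ^+ 2.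
  rewrite !sqr_normcE.
  by case: b {b1 wE w2 v2 N1 E} => u v /=; ring.
rewrite (E 2%N) in w2; rewrite E1 (E 3%N) in v2.
have := ler_Re_normc b; rewrite ler_norml => /andP[u1 u2].
have N0 : 0 <= normc b ^+ 2 by rewrite sqr_ge0.
set N := normc b ^+ 2 in w2 v2 N1 N0; set u := complex.Re b in w2 v2 u1 u2.
have uu1 : u <= 1 by apply: le_trans u2 b1.
have uu2 : -1 <= u by apply: le_trans u1; rewrite lerN2.
have h1 : N * (2 ^+ 2 + 2 * 2 * u + N) <= 5 + 4 * u.
  apply: le_trans (_ : 1 * (5 + 4 * u) <= _); last by rewrite mul1r.
  by rewrite ler_pM //; lra.
have E1' : 1 - 2 * u + N >= 0 by rewrite -E1 sqr_ge0.
have h2 : (1 - 2 * u + N) * (3 ^+ 2 + 2 * 3 * u + N) <= 2 * (1 - u) * 16.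
  by rewrite ler_pM //; lra.
lra.
Qed.

(* w = b (2 + b) / 3 with b = ((2 + f) / 3)^n, where f peaks inside the neighbourhood. *)
Lemma peaking_unit y0 hs e : G y0 -> 0 < e -> exists w y1,
  [/\ w \is a GRing.unit, G y1 /\ ptws_nbhd y0 hs e y1, y1 w = 1,
      forall x, characters A x ->
        normc (x w) <= 1 /\ normc (1 - x w) ^+ 2 <= 8 * (1 - normc (x w) ^+ 2)
    & forall y, G y -> normc (y w) <= e \/ ptws_nbhd y0 hs e y].
Proof.
move=> Gy0 e0; have [f [y1 [q [[Gy1 Vy1] y1f f1 /andP[q0 q1] fq]]]] := pG hs Gy0 e0.
have q01 : 0 <= (2 + q) / 3 < 1.
  by rewrite divr_ge0 ?addr_ge0 //= ltr_pdivrMr //; lra.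
have [n Hn] := exp_small q01 e0.
have n2 : normc (2 : R[i]) = 2 by rewrite -(rmorph_nat (real_complex R) 2) normc_id.
have n3 : normc (3 : R[i]) = 3 by rewrite -(rmorph_nat (real_complex R) 3) normc_id.
(* As |f| <= 1, neither 2 + f nor 2 + b vanishes at a character, so w is invertible; the power makes
   b small where |f| <= q and keeps the value 1 at y1. *)
pose b0 := 3^-1 *: (2%:A + f); pose b := b0 ^+ n.
pose w := 3^-1 *: (b * (2%:A + b)).
have b0E x : characters A x -> x b0 = (2 + x f) / 3.
  by move=> xX; rewrite charZ // charD // char_scalar // mulrC.
have bE x : characters A x -> x b = ((2 + x f) / 3) ^+ n by move=> xX; rewrite charX // b0E.
have wE x : characters A x -> x w = x b * (2 + x b) / 3.
  by move=> xX; rewrite charZ // charM // charD // char_scalar // mulrC.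
have b0le x : characters A x -> normc ((2 + x f) / 3) <= (2 + normc (x f)) / 3.
  move=> xX; rewrite Normc.normcM Normc.normcV n3 ler_pM2r ?invr_gt0 //.
  by have := ler_normcD 2 (x f); rewrite n2.
have ble1 x : characters A x -> normc (x b) <= 1.
  move=> xX; rewrite bE // normcX exprn_ile1 ?normc_ge0 //.
  apply: le_trans (b0le x xX) _; rewrite ler_pdivrMr //.
  by have := f1 x xX; lra.
have neq0 (z : R[i]) : normc z <= 1 -> 2 + z != 0.
  move=> z1; apply/eqP => E; have := ler_normcD (2 + z) (- z).
  by rewrite addrK normcN n2 E Normc.normc0; lra.
have n30 : 3^-1 != 0 :> R[i] by rewrite invr_neq0 // pnatr_eq0.
exists w, y1; split => //.
- apply/unit_charP => x xX; rewrite wE // !mulf_neq0 //; last first.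
    by rewrite neq0 // ble1.
  by rewrite bE // expf_neq0 // mulf_neq0 // neq0 // f1.
- have y1X := boundary_char Gy1; rewrite wE // bE // y1f.
  have -> : (2 + 1) / 3 = 1 :> R[i] by rewrite -[2 + 1](natrD _ 2 1) mulfV // pnatr_eq0.
  by rewrite expr1n mul1r -[2 + 1](natrD _ 2 1) mulfV // pnatr_eq0.
- move=> x xX; have [h1 h2] := peaking_disc (ble1 x xX) (wE x xX).
  by split => //; apply: le_trans h1 (ble1 x xX).
move=> y Gy; have [yq|] := fq y Gy; [left|by right].
have yX := boundary_char Gy.
have [h1 _] := peaking_disc (ble1 y yX) (wE y yX).
apply: le_trans h1 _; apply: le_trans Hn; rewrite bE // normcX lerXn2r ?nnegrE ?normc_ge0 //.
  by rewrite divr_ge0 ?addr_ge0.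
apply: le_trans (b0le y yX) _; rewrite ler_pM2r ?invr_gt0 //; lra.
Qed.

End PeakingBoundary.

(** * Spectral radius and localization at a boundary point *)

Section SpectralRadius.
Context (R : realType) (A : comBanachAlgType R).
Implicit Types (f g : A) (c : R[i]).

Lemma spectral_radius_ge0 f : 0 <= rho f.
Proof. by have [x xX <-] := spectral_radius_attained f; exact: normc_ge0. Qed.

Lemma spectral_radiusZ c f : rho (c *: f) = normc c * rho f.
Proof.
apply/eqP; rewrite eq_le; apply/andP; split.
  apply: spectral_radius_le => x xX; rewrite charZ // Normc.normcM.
  by rewrite ler_wpM2l ?normc_ge0 // normc_char_le.
have [x xX <-] := spectral_radius_attained f.
by rewrite -Normc.normcM -(charZ xX); exact: normc_char_le.
Qed.

Lemma spectral_radiusD f g : rho (f + g) <= rho f + rho g.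
Proof.
apply: spectral_radius_le => x xX; rewrite charD //.
by apply: le_trans (ler_normcD _ _) _; rewrite lerD // normc_char_le.
Qed.

Lemma spectral_radius_scalar c : rho (c%:A : A) = normc c.
Proof.
by have [x xX <-] := spectral_radius_attained (c%:A : A); rewrite char_scalar.
Qed.

Lemma spectral_radiusB_scalar f c : rho f <= rho (f - c%:A) + normc c.
Proof.
by have := spectral_radiusD (f - c%:A) c%:A; rewrite subrK spectral_radius_scalar.
Qed.

Lemma spectral_radius_subr_scalar f c : rho (f - c%:A) <= rho f + normc c.
Proof.
have := spectral_radiusD f (- c%:A).
by rewrite -scaleNr spectral_radius_scalar normcN.
Qed.

Lemma spectral_radius_eq0 f : semisimple A -> rho f = 0 -> f = 0.
Proof.
move=> ss f0; apply: semisimple_gelfand0 => // x xX.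
apply: Normc.eq0_normc; apply/eqP; rewrite eq_le normc_ge0 andbT -f0.
exact: normc_char_le.
Qed.

Lemma addr_scalar_unit f c : rho f < normc c -> f + c%:A \is a GRing.unit.
Proof.
move=> fc; apply/unit_charP => x xX; rewrite charD // char_scalar // addr_eq0.
apply/eqP => E; have := normc_char_le f xX; rewrite E normcN.
by rewrite leNgt fc.
Qed.

Lemma scalar_unit c : c != 0 -> (c%:A : A) \is a GRing.unit.
Proof. by move=> c0; rewrite scaler_unit ?unitfE // unitr1. Qed.

Lemma spectral_radius_uniq f g : (forall x : A -> R[i], characters A x -> x f = x g) ->
  rho f = rho g.
Proof.
move=> H; apply/eqP; rewrite eq_le; apply/andP; split; apply: spectral_radius_le => x xX.
  by rewrite H // normc_char_le.
by rewrite -H // normc_char_le.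
Qed.

Context (G : set {ptws A -> R[i]}) (bG : boundary G) (pG : peaking G).

Lemma boundary_eq0 f : semisimple A -> (forall y, G y -> y f = 0) -> f = 0.
Proof.
move=> ss H; apply: spectral_radius_eq0 => //.
by have [_ /(_ f) [y Gy <-]] := bG; rewrite H // Normc.normc0.
Qed.

(** Multiplication by a peaking unit turns the modulus at y0 into a spectral radius, for a finite
    list of h with the same w. Thus relations between spectral radii can be read pointwise on G. *)
Lemma peak_localization y0 (hs : seq A) e : G y0 -> 0 < e -> exists2 w,
  w \is a GRing.unit & forall h, h \in hs -> `|rho (w * h) - normc (y0 h)| <= e.
Proof.
move=> Gy0 e0.
have [d d0 Hd] : exists2 d, 0 < d & forall h, h \in hs -> d <= e /\ d * rho h <= e.
  apply: common_eps => h _; have r0 := spectral_radius_ge0 h.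
  have r1 : 0 < rho h + 1 by rewrite ltr_wpDl.
  exists (Num.min e (e / (rho h + 1))); first by rewrite lt_min e0 divr_gt0.
  move=> d /andP[d0]; rewrite le_min => /andP[de]; rewrite ler_pdivlMr // => h2.
  split=> //; apply: le_trans h2; rewrite ler_wpM2l ?(ltW d0) // lerDl //.
have [w [y1 [wu [Gy1 Vy1] y1w wX wG]]] := peaking_unit bG pG hs Gy0 d0.
exists w => // h hhs; have [de dr] := Hd h hhs.
have y1X := boundary_char bG Gy1.
have hy1 : normc (y1 h) <= rho (w * h).
  by have := normc_char_le (w * h) y1X; rewrite charM // y1w mul1r.
have h1 := ler_dist_normc (y1 h) (y0 h); have h2 := Vy1 h hhs.
have [_ /(_ (w * h)) [y Gy yE]] := bG; have yX := boundary_char bG Gy.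
have hy : rho (w * h) <= normc (y0 h) + e.
  rewrite -yE charM // Normc.normcM; have [yw|Vy] := wG y Gy.
    apply: le_trans (_ : d * rho h <= _); first by rewrite ler_pM ?normc_ge0 // normc_char_le.
    by apply: le_trans dr _; rewrite lerDr normc_ge0.
  have [yw _] := wX y yX; have h3 := ler_dist_normc (y h) (y0 h); have h4 := Vy h hhs.
  apply: le_trans (_ : 1 * normc (y h) <= _); first by rewrite ler_wpM2r ?normc_ge0.
  by move: h3; rewrite ler_norml => /andP[]; lra.
by move: h1; rewrite !ler_norml => /andP[]; move=> ? ?; apply/andP; split; lra.
Qed.

End SpectralRadius.

(** * Maps on invertible groups *)

Section PhaseRigidity.
Context (R : realType).
Implicit Types (u w z : R[i]) (M : R).

(** The second condition is |w - 1/9| <= 8/9 written out; in this form it bounds |1 - w| by the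
    defect 1 - |w|^2. *)
Definition in_peak_disc w := normc w <= 1 /\ normc (1 - w) ^+ 2 <= 8 * (1 - normc w ^+ 2).

Lemma sqr_normc_sub1 u : normc (u - 1) ^+ 2 = normc u ^+ 2 - 2 * Re u + 1.
Proof. by rewrite !sqr_normcE; case: u => a b /=; ring. Qed.

Lemma ReB u w : Re (u - w) = Re u - Re w.
Proof. by case: u; case: w. Qed.

Lemma Re_le_normc u : Re u <= normc u.
Proof. by apply: le_trans (ler_norm _) (ler_Re_normc u). Qed.

Lemma sqr_le_add (x y e : R) : 0 <= x -> x <= y + e -> x ^+ 2 <= y ^+ 2 + 2 * e * y + e ^+ 2.
Proof.
move=> x0 xy; have -> : y ^+ 2 + 2 * e * y + e ^+ 2 = (y + e) ^+ 2 by ring.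
by rewrite lerXn2r ?nnegrE // (le_trans x0).
Qed.

Lemma eq1_of_Re u : normc u = 1 -> 1 <= Re u -> u = 1.
Proof.
move=> u1 ur; have h : normc u ^+ 2 = 1 by rewrite u1 expr1n.
rewrite sqr_normcE in h; case: u ur h {u1} => a b /= a1 h.
have a11 : 1 <= a ^+ 2 by rewrite -[1](expr1n _ 2) lerXn2r ?nnegrE // (le_trans ler01).
have b0 : b = 0 by apply/eqP; rewrite -sqrf_eq0 eq_le sqr_ge0 andbT; lra.
rewrite b0 in h *; congr (_ +i* _).
have : a ^+ 2 = 1 by rewrite -h; ring.
by move/eqP; rewrite sqrf_eq1 => /orP[/eqP //|/eqP E]; move: a1; rewrite E; lra.
Qed.

(** Write U = |u| and D = |1 - w|. Squaring the hypothesis gives U^2 (1 - |w|^2) <= 2UD + k, and the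
    disc gives D^2 <= 8 (1 - |w|^2). So X = UD satisfies X^2 <= 8 (2X + k) and is bounded
    independently of U. *)
Lemma peak_disc_slack u w (e k : R) : in_peak_disc w -> 0 <= k ->
  normc (u - 1) <= normc (u * w - 1) + e -> 0 <= e -> 2 * e * (normc u + 1) + e ^+ 2 <= k ->
  normc u * normc (1 - w) <= 16 + 8 * k /\
  normc u ^+ 2 * (1 - normc w ^+ 2) <= 2 * (16 + 8 * k) + k.
Proof.
move=> [w1 wD] k0 h e0 hk.
have := sqr_le_add (normc_ge0 _) h; rewrite !sqr_normc_sub1 Normc.normcM exprMn => h2.
have h3 : normc (u * w - 1) <= normc u + 1.
  apply: le_trans (ler_normcD _ _) _; rewrite normcN Normc.normc1 lerD2r Normc.normcM.
  by rewrite ler_piMr ?normc_ge0.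
have h4 : 2 * e * normc (u * w - 1) <= 2 * e * (normc u + 1).
  by rewrite ler_wpM2l // mulr_ge0.
have h5 : Re u - Re (u * w) <= normc u * normc (1 - w).
  rewrite -ReB -Normc.normcM mulrBr mulr1; exact: Re_le_normc.
set U := normc u in h2 h3 h4 h5 hk *; set D := normc (1 - w) in wD h5 *.
set N := normc w ^+ 2 in wD h2 *.
have D0 : 0 <= D by exact: normc_ge0.
have U0 : 0 <= U by exact: normc_ge0.
have h6 : U ^+ 2 * (1 - N) <= 2 * (U * D) + k by lra.
have h7 : (U * D) ^+ 2 <= 8 * (2 * (U * D) + k).
  rewrite exprMn; apply: le_trans (_ : U ^+ 2 * (8 * (1 - N)) <= _).
    by rewrite ler_wpM2l ?sqr_ge0.
  by rewrite mulrCA ler_pM2l.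
have h8 : U * D <= 16 + 8 * k.
  rewrite leNgt; apply/negP => hX; set X := U * D in hX h7.
  have : (16 + 8 * k) * X < X * X by rewrite ltr_pM2r //; lra.
  have : 8 * k * 1 <= 8 * k * X by rewrite ler_wpM2l //; lra.
  by rewrite expr2 in h7; lra.
by split=> //; lra.
Qed.

(** The bound is (M - 1)^2 + 8: moving w away from 1 inside the disc gains at most 2MD - (MD)^2 / 8
    <= 8, where D = |1 - w|. *)
Lemma peak_disc_sup M w : 0 <= M -> in_peak_disc w ->
  normc (M%:C * w - 1) ^+ 2 <= M ^+ 2 - 2 * M + 9.
Proof.
move=> M0 [w1 wD]; rewrite sqr_normc_sub1 Normc.normcM exprMn normc_id //.
have h : 1 - Re w <= normc (1 - w).
  by have := Re_le_normc (1 - w); rewrite ReB.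
have -> : Re (M%:C * w) = M * Re w by case: w {w1 wD h} => a b /=; ring.
set D := normc _ in wD h; set N := normc w ^+ 2 in wD *.
have h1 : M * (1 - Re w) <= M * D by rewrite ler_wpM2l.
have h2 : M ^+ 2 * D ^+ 2 <= M ^+ 2 * (8 * (1 - N)) by rewrite ler_wpM2l ?sqr_ge0.
have := sqr_ge0 (M * D - 8); rewrite sqrrB exprMn; lra.
Qed.

(** By the first inequality M |1 - w| and M^2 (1 - |w|^2) stay bounded, so |M eta w - 1|^2 is M^2 -
    2M Re eta up to a bounded term. By the second it is at most M^2 - 2M plus a bounded term.
    Letting M grow forces Re eta >= 1. *)
Lemma phase_rigidity (c eta : R[i]) : c != 0 -> normc eta = 1 ->
  (forall M, 1 <= M -> 4 <= M * normc c -> exists w w',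
    [/\ in_peak_disc w, in_peak_disc w',
        normc (M%:C * c * eta - 1) <= normc (M%:C * c * eta * w - 1) + M^-1
      & normc (M%:C * eta * w - 1) <= normc (M%:C * w' - 1) + M^-1]) ->
  eta = 1.
Proof.
move=> c0 eta1 H; apply: eq1_of_Re => //.
have k0 : 0 < normc c by rewrite normc_gt0.
set k := normc c in k0 H.
(* [K] bounds 2 M^-1 (Mk + 1) + M^-2 for M >= 1, [X] is the bound that [peak_disc_slack] then gives,
   and [C] collects the bounded terms. *)
pose K := 2 * k + 3; pose X := 16 + 8 * K.
pose C := 13 + (2 * X + K) / k ^+ 2 + 2 * (X / k).
have K0 : 0 <= K by rewrite addr_ge0 // mulr_ge0 // ltW.
have X0 : 0 <= X by rewrite addr_ge0 // mulr_ge0.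
have C0 : 0 <= C.
  by rewrite !addr_ge0 ?divr_ge0 ?mulr_ge0 ?addr_ge0 ?mulr_ge0 ?invr_ge0 ?sqr_ge0 // ?ltW.
have main M : 1 <= M -> 4 <= M * k -> 2 * M * (1 - Re eta) <= C.
  move=> M1 Mk; have [w [w' [dw dw' h1 h2]]] := H M M1 Mk.
  have M0 : 0 < M by apply: lt_le_trans M1.
  have Mi0 : 0 < M^-1 by rewrite invr_gt0.
  have Mi1 : M^-1 <= 1 by rewrite invf_le1.
  have MiM : M * M^-1 = 1 by rewrite mulfV // gt_eqF.
  have Mi2 : M^-1 ^+ 2 <= 1 by rewrite expr_le1 // ltW.
  have nu : normc (M%:C * c * eta) = M * k.
    by rewrite !Normc.normcM eta1 mulr1 normc_id // ltW.
  have [] := peak_disc_slack (k := K) dw K0 h1 (ltW Mi0).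
    rewrite nu; have -> : 2 * M^-1 * (M * k + 1) = 2 * k * (M * M^-1) + 2 * M^-1 by ring.
    by rewrite MiM /K; lra.
  rewrite nu -/X => hX ht.
  have hD : M * normc (1 - w) <= X / k by rewrite ler_pdivlMr // mulrAC.
  have hT : M ^+ 2 * (1 - normc w ^+ 2) <= (2 * X + K) / k ^+ 2.
    by rewrite ler_pdivlMr ?exprn_gt0 // mulrAC -exprMn.
  have := sqr_le_add (normc_ge0 _) h2.
  have := peak_disc_sup (ltW M0) dw'.
  have h3 : normc (M%:C * w' - 1) <= M + 1.
    apply: le_trans (ler_normcD _ _) _; rewrite normcN Normc.normc1 lerD2r Normc.normcM.
    by rewrite (normc_id (ltW M0)) ler_piMr ?(ltW M0) //; case: dw'.
  have h4 : 2 * M^-1 * normc (M%:C * w' - 1) <= 4.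
    apply: le_trans (_ : 2 * M^-1 * (M + 1) <= _).
      by rewrite ler_pM2l // mulr_gt0.
    have -> : 2 * M^-1 * (M + 1) = 2 * (M * M^-1) + 2 * M^-1 by ring.
    by rewrite MiM; lra.
  rewrite (sqr_normc_sub1 (M%:C * eta * w)) !Normc.normcM eta1 mulr1 (normc_id (ltW M0)) // exprMn => h5 h6.
  have h7 : Re (M%:C * eta * w) <= M * Re eta + M * normc (1 - w).
    have -> : M * Re eta = Re (M%:C * eta) by case: (eta) => a b /=; ring.
    have h8 := Re_le_normc (M%:C * eta * w - M%:C * eta); rewrite ReB in h8.
    have h9 : normc (M%:C * eta * w - M%:C * eta) = M * normc (1 - w).
      rewrite -[X in _ - X]mulr1 -mulrBr !Normc.normcM eta1 mulr1 normcB normc_id // ltW //.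
    by rewrite h9 in h8; lra.
  rewrite /C; lra.
rewrite -subr_le0 -(@ler_pM2l _ 2) // mulr0; apply: (@le_of_scaled _ _ _ (C + 2 * (1 + 4 / k))) => t t0.
have eta_le : Re eta <= 1 by rewrite -eta1 Re_le_normc.
pose M := t + (1 + 4 / k).
have k4 : 0 <= 4 / k by rewrite divr_ge0 // ltW.
have M1 : 1 <= M by rewrite /M; lra.
have Mk : 4 <= M * k.
  rewrite -ler_pdivrMr //; rewrite /M; lra.
have := main M M1 Mk.
have : 0 <= (1 + 4 / k) * (1 - Re eta) by rewrite mulr_ge0 ?subr_ge0 // addr_ge0.
by rewrite /M; lra.
Qed.

End PhaseRigidity.

(** * Norm identities and homogeneity of [T] *)

Section Preserver.
Context (R : realType) (A B : comBanachAlgType R) (T : A -> B) (alpha : R[i]).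
Context (ssA : semisimple A)
  (T_onto : T @` [set f | f \is a GRing.unit] = [set g | g \is a GRing.unit])
  (alpha0 : alpha != 0)
  (T_per : forall f g : A, f \is a GRing.unit -> g \is a GRing.unit ->
     peripheral_spectrum (T f * T g - alpha%:A) `&`
     peripheral_spectrum (f * g - alpha%:A) !=set0).

Lemma preserver_unit f : f \is a GRing.unit -> T f \is a GRing.unit.
Proof.
move=> fu; have : (T @` [set f | f \is a GRing.unit]) (T f) by exists f.
by rewrite T_onto.
Qed.

Lemma preserver_surj g : g \is a GRing.unit -> exists2 f, f \is a GRing.unit & T f = g.
Proof.
move=> gu; have : [set g : B | g \is a GRing.unit] g by [].
by rewrite -T_onto => -[f fu <-]; exists f.
Qed.

Lemma preserver_norm f g : f \is a GRing.unit -> g \is a GRing.unit ->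
  rho (T f * T g - alpha%:A) = rho (f * g - alpha%:A).
Proof.
move=> fu gu; have [z [/peripheral_spectrumP [_ <-] /peripheral_spectrumP [_ <-]]] := T_per fu gu.
by [].
Qed.

Lemma spectral_radius0 (C : comBanachAlgType R) : rho (0 : C) = 0.
Proof. by rewrite -(scale0r (0 : C)) spectral_radiusZ Normc.normc0 mul0r. Qed.

(** If all characters kill b, then T 1 + b is invertible, hence equal to T f for some f. Testing f
    and 1 against the constant alpha, for which 1 alpha - alpha = 0, gives rho (alpha f - alpha) =
    0; so f = 1 and b = 0. *)
Lemma semisimple_range : semisimple B.
Proof.
apply: gelfand0_semisimple => b b0.
have bu : T 1 + b \is a GRing.unit.
  apply/unit_charP => y yX; rewrite charD // b0 // addr0 char_unit //.
  exact: preserver_unit (unitr1 A).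
have [f fu Tf] := preserver_surj bu.
have au := scalar_unit A alpha0.
have : rho (f * alpha%:A - alpha%:A) = 0.
  rewrite -preserver_norm // Tf.
  have -> : rho ((T 1 + b) * T alpha%:A - alpha%:A) = rho (T 1 * T alpha%:A - alpha%:A).
    apply: spectral_radius_uniq => y yX.
    by rewrite !(charB yX) !(charM yX) (charD yX) (b0 y yX) addr0.
  by rewrite preserver_norm ?unitr1 // mul1r subrr spectral_radius0.
move/spectral_radius_eq0 => /(_ ssA) /eqP.
rewrite -[X in _ - X]mul1r -mulrBl => /eqP h.
have f1 : f = 1.
  by apply/eqP; rewrite -subr_eq0 -(mulrK au (f - 1)) h mul0r.
by move/eqP: Tf; rewrite f1 -subr_eq0 opprD addrA subrr add0r oppr_eq0 => /eqP.
Qed.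

Let ssB := semisimple_range.

Let TM_near f g : f \is a GRing.unit -> g \is a GRing.unit ->
  rho (T f * T g) <= rho (f * g) + 2 * normc alpha /\
  rho (f * g) <= rho (T f * T g) + 2 * normc alpha.
Proof.
move=> fu gu; have E := preserver_norm fu gu.
have := spectral_radiusB_scalar (T f * T g) alpha; have := spectral_radius_subr_scalar (T f * T g) alpha.
have := spectral_radiusB_scalar (f * g) alpha; have := spectral_radius_subr_scalar (f * g) alpha.
by rewrite E; split; lra.
Qed.

(** Homogeneity of T is still unknown, so the large factor t is put on b, and surjectivity writes
    the product as T f; the scalar c is taken out on the side of A. *)
Let TZ_norm_le b c g : b \is a GRing.unit -> c != 0 -> g \is a GRing.unit ->
  rho (b * T (c *: g)) <= normc c * rho (b * T g).
Proof.
move=> bu c0 gu.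
have cgu : c *: g \is a GRing.unit by rewrite scaler_unit // unitfE.
apply: (@le_of_scaled _ _ _ (normc c * (2 * normc alpha) + 2 * normc alpha)) => t t0.
have tb : t%:C *: b \is a GRing.unit.
  by rewrite scaler_unit // unitfE -normc_gt0 normc_id // ltW.
have [f fu Tf] := preserver_surj tb.
have [h1 _] := TM_near fu cgu; have [_ h2] := TM_near fu gu.
rewrite -scalerAr spectral_radiusZ Tf -!scalerAl !spectral_radiusZ (normc_id (ltW t0)) in h1 h2.
have : normc c * rho (f * g) <= normc c * (t * rho (b * T g) + 2 * normc alpha).
  by rewrite ler_wpM2l ?normc_ge0.
by lra.
Qed.

Let TZ_norm b c g : b \is a GRing.unit -> c != 0 -> g \is a GRing.unit ->
  rho (b * T (c *: g)) = normc c * rho (b * T g).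
Proof.
move=> bu c0 gu; apply/eqP; rewrite eq_le TZ_norm_le //=.
have cgu : c *: g \is a GRing.unit by rewrite scaler_unit // unitfE.
rewrite -ler_pdivlMl ?normc_gt0 // -Normc.normcV.
have := TZ_norm_le bu (invr_neq0 c0) cgu.
by rewrite scalerA mulVf // scale1r.
Qed.

Lemma preserver_normM f g : f \is a GRing.unit -> g \is a GRing.unit -> rho (T f * T g) = rho (f * g).
Proof.
move=> fu gu; apply/eqP; rewrite eq_le; apply/andP; split;
  apply: (@le_of_scaled _ _ _ (2 * normc alpha)) => t t0.
all: have t0' : t%:C != 0 by rewrite -normc_gt0 normc_id // ltW.
all: have tgu : t%:C *: g \is a GRing.unit by rewrite scaler_unit // unitfE.
all: have [] := TM_near fu tgu.
all: rewrite -scalerAr spectral_radiusZ (TZ_norm (preserver_unit fu) t0' gu) (normc_id (ltW t0)) //.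
Qed.

Context (G : set {ptws B -> R[i]}) (bG : boundary G) (pG : peaking G).

Let preserverZ_abs_le y c f : G y -> c != 0 -> f \is a GRing.unit ->
  normc (y (T (c *: f))) <= normc c * normc (y (T f)).
Proof.
move=> Gy c0 fu; apply: (@le_of_eps _ _ _ (normc c + 1)); first by rewrite addr_ge0 ?normc_ge0.
move=> e e0.
have [w wu Hw] := peak_localization bG pG [:: T f; T (c *: f)] Gy e0.
have := Hw (T f); have := Hw (T (c *: f)); rewrite !inE !eqxx orbT => /(_ isT) h1 /(_ isT) h2.
rewrite TZ_norm // in h1; move: h1 h2; rewrite !ler_norml => /andP[h1 _] /andP[_ h2].
have : normc c * (rho (w * T f) - normc (y (T f))) <= normc c * e by rewrite ler_wpM2l ?normc_ge0.
by lra.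
Qed.

Lemma preserverZ_abs y c f : G y -> c != 0 -> f \is a GRing.unit ->
  normc (y (T (c *: f))) = normc c * normc (y (T f)).
Proof.
move=> Gy c0 fu; apply/eqP; rewrite eq_le preserverZ_abs_le //=.
have cfu : c *: f \is a GRing.unit by rewrite scaler_unit // unitfE.
rewrite -ler_pdivlMl ?normc_gt0 // -Normc.normcV.
have := preserverZ_abs_le Gy (invr_neq0 c0) cfu.
by rewrite scalerA mulVf // scale1r.
Qed.

(** The test element g has T g = K w with w peaking near y0. A common peripheral value of T (c f) T
    g - alpha and c f g - alpha is attained at some y' in G and at a character x' of A. Maximality
    at y' gives the first inequality; at x' the value of f g - alpha is then known, and bounding it
    by rho (T f T g - alpha) gives the second. *)
Let peak_comparison y0 c f M : G y0 -> c != 0 -> f \is a GRing.unit -> 1 <= M -> 4 <= M * normc c ->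
  let eta := y0 (T (c *: f)) / (c * y0 (T f)) in
  exists w w', [/\ in_peak_disc w, in_peak_disc w',
        normc (M%:C * c * eta - 1) <= normc (M%:C * c * eta * w - 1) + M^-1
      & normc (M%:C * eta * w - 1) <= normc (M%:C * w' - 1) + M^-1].
Proof.
move=> Gy0 c0 fu M1 Mc eta.
have fieldE1 (b s : R[i]) : M%:C * eta * s - 1 =
    (M%:C * (b / c) * s - 1) + M%:C * (c * eta - b) * s * c^-1 by field.
have fieldE2 (b s : R[i]) :
    c * (alpha * (M%:C * (b / c) * s - 1)) = alpha * (M%:C * b * s - 1) + alpha - c * alpha by field.
have y0X := boundary_char bG Gy0.
have cfu : c *: f \is a GRing.unit by rewrite scaler_unit // unitfE.
set a := y0 (T f); have a0 : a != 0 by apply: char_unit (preserver_unit fu).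
have k0 : 0 < normc a by rewrite normc_gt0.
have A0 : 0 < normc alpha by rewrite normc_gt0.
have nc0 : 0 < normc c by rewrite normc_gt0.
have M0 : 0 < M by apply: lt_le_trans M1.
have ceta : c * eta = y0 (T (c *: f)) / a by rewrite /eta invfM mulrCA (mulrA c) mulfV // mul1r.
have nceta : normc (c * eta) = normc c.
  by rewrite ceta Normc.normcM Normc.normcV preserverZ_abs // mulfK // gt_eqF.
pose P := rho (T f); pose Q := rho (T (c *: f)).
have P0 : 0 <= P := spectral_radius_ge0 _; have Q0 : 0 <= Q := spectral_radius_ge0 _.
pose C := 2 + P + Q + (normc c)^-1.
have nci0 : 0 < (normc c)^-1 by rewrite invr_gt0.
have C2 : 2 <= C by rewrite /C; lra.
(* [th] is what an error e becomes after multiplication by M / |a|; the factor [C] makes all errors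
   add up to 1 / (2M). *)
pose th := (2 * M * C)^-1; pose e := normc a * th / M.
have D0 : 0 < 2 * M * C by rewrite !mulr_gt0 //; lra.
have th0 : 0 < th by rewrite invr_gt0.
have e0 : 0 < e by rewrite divr_gt0 ?mulr_gt0.
have thC : th * C = 2^-1 * M^-1.
  by rewrite /th; field; rewrite !gt_eqF //; lra.
have Mi0 : 0 < M^-1 by rewrite invr_gt0.
have Mi1 : M^-1 <= 1 by rewrite invf_le1.
have thE : M * (e / normc a) = th by rewrite /e; field; rewrite !gt_eqF.
have thP : 0 <= th * P by rewrite mulr_ge0 // ltW.
have thQ : 0 <= th * Q by rewrite mulr_ge0 // ltW.
have thc : 0 < th * (normc c)^-1 by rewrite mulr_gt0.
have thS : 2 * th + th * P + th * Q + th * (normc c)^-1 = 2^-1 * M^-1 by rewrite -thC /C; ring.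
have [w [y1 [wu [Gy1 Vy1] y1w wX wG]]] := peaking_unit bG pG [:: T f; T (c *: f)] Gy0 e0.
(* With this scalar, h T g - alpha takes the values alpha (M (h / a) w - 1), so that alpha is a
   common factor. *)
pose K := M%:C * alpha / a.
have K0 : K != 0 by rewrite !mulf_neq0 ?invr_neq0 // -normc_gt0 normc_id // ltW.
have Kwu : K *: w \is a GRing.unit by rewrite scaler_unit // unitfE.
have [g gu Tg] := preserver_surj Kwu.
have val (y : B -> R[i]) h : characters B y ->
    y (h * T g - alpha%:A) = alpha * (M%:C * (y h / a) * y w - 1).
  by move=> yX; rewrite charB // charM // Tg charZ // char_scalar // /K; field.
have dil (u v t : R[i]) : normc t <= 1 -> normc (u - v) <= e / normc a ->
    normc (M%:C * u * t - 1) <= normc (M%:C * v * t - 1) + th.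
  move=> t1 uv; rewrite -thE.
  have -> : M%:C * u * t - 1 = (M%:C * v * t - 1) + M%:C * (u - v) * t by ring.
  apply: le_trans (ler_normcD _ _) _; rewrite lerD2l !Normc.normcM (normc_id (ltW M0)).
  rewrite -mulrA ler_pM2l // -[leRHS]mulr1 ler_pM ?normc_ge0 //.
have smallw (t s : R[i]) r : normc s <= e -> normc t <= r ->
    normc (M%:C * (t / a) * s - 1) <= th * r + 1.
  move=> se tr; apply: le_trans (ler_normcD _ _) _; rewrite normcN Normc.normc1 lerD2r.
  rewrite !Normc.normcM Normc.normcV (normc_id (ltW M0)) -thE.
  have -> : M * (e / normc a) * r = M * (r / normc a) * e by ring.
  rewrite ler_pM ?normc_ge0 // ?mulr_ge0 ?normc_ge0 ?invr_ge0 ?normc_ge0 ?(ltW M0) //.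
  by rewrite ler_pM2l // ler_pM2r // invr_gt0.
have nearE (y : {ptws B -> R[i]}) h : ptws_nbhd y0 [:: T f; T (c *: f)] e y ->
    h \in [:: T f; T (c *: f)] -> normc (y h / a - y0 h / a) <= e / normc a.
  move=> yV hh; rewrite -mulrBl Normc.normcM Normc.normcV ler_pM2r ?invr_gt0 // ltW //.
  exact: yV.
have hcf : T (c *: f) \in [:: T f; T (c *: f)] by rewrite !inE eqxx orbT.
have hf : T f \in [:: T f; T (c *: f)] by rewrite !inE eqxx.
have [z [zB /peripheral_spectrumP [[x' x'X x'z] _]]] := T_per cfu gu.
have [y' Gy' y'z] := boundary_peripheral bG zB.
have [_ zr] := (peripheral_spectrumP _ _).1 zB.
have y'X := boundary_char bG Gy'; have y1X := boundary_char bG Gy1.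
rewrite val // in y'z.
set b' := y' (T (c *: f)) / a in y'z.
have max1 : normc (M%:C * (y1 (T (c *: f)) / a) * 1 - 1) <= normc (M%:C * b' * y' w - 1).
  have v1 := val _ (T (c *: f)) y1X; rewrite y1w in v1.
  by rewrite -(ler_pM2l A0) -!Normc.normcM y'z zr -v1; exact: normc_char_le.
have [w'1 w'D] := wX y' y'X.
have one1 : normc (1 : R[i]) <= 1 by rewrite Normc.normc1.
have max0 : normc (M%:C * c * eta - 1) <= normc (M%:C * b' * y' w - 1) + th.
  have h : normc (c * eta - y1 (T (c *: f)) / a) <= e / normc a.
    by rewrite ceta normcB nearE.
  by have := dil _ _ 1 one1 h; rewrite mulr1 mulrA; lra.
(* Off the neighbourhood the modulus would be at most 1 + th Q, but it is at least M |c| - 1 - th;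
   this is where 4 <= M |c| is used. *)
have y'V : ptws_nbhd y0 [:: T f; T (c *: f)] e y'.
  have [y'w|//] := wG y' Gy'; exfalso.
  have h1 := smallw _ _ _ y'w (normc_char_le (T (c *: f)) y'X).
  have h2 : M * normc c - 1 <= normc (M%:C * c * eta - 1).
    have := ler_normcD (M%:C * c * eta - 1) 1; rewrite subrK Normc.normc1.
    by rewrite -mulrA Normc.normcM nceta (normc_id (ltW M0)); lra.
  by rewrite -/b' -/Q in h1; lra.
have b'E : normc (b' - c * eta) <= e / normc a by rewrite ceta nearE.
have [_ /(_ (T f * T g - alpha%:A)) [y'' Gy'' y''E]] := bG.
have y''X := boundary_char bG Gy''; rewrite val // in y''E.
(* At x' the element c f g equals z + alpha, and dividing by c gives the value of f g there. *)
have max2 : normc (M%:C * (b' / c) * y' w - 1) <= normc (M%:C * (y'' (T f) / a) * y'' w - 1).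
  rewrite -(ler_pM2l A0) -!Normc.normcM y''E preserver_norm //.
  have -> : alpha * (M%:C * (b' / c) * y' w - 1) = x' (f * g - alpha%:A).
    rewrite charB // char_scalar //.
    move: x'z; rewrite -scalerAl charB // charZ // char_scalar // -y'z => /eqP.
    by rewrite subr_eq => /eqP E; apply: (mulfI c0); rewrite [RHS]mulrBr E fieldE2.
  exact: normc_char_le.
have max3 : normc (M%:C * eta * y' w - 1) <=
    normc (M%:C * (y'' (T f) / a) * y'' w - 1) + th * (normc c)^-1.
  apply: le_trans (_ : normc (M%:C * (b' / c) * y' w - 1) + th * (normc c)^-1 <= _).
    rewrite (fieldE1 b'); apply: le_trans (ler_normcD _ _) _; rewrite lerD2l !Normc.normcM Normc.normcV.
    rewrite ler_pM2r // (normc_id (ltW M0)) -mulrA -thE ler_pM2l // normcB -[leRHS]mulr1.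
    by rewrite ler_pM ?normc_ge0.
  by rewrite lerD2r.
have [y''w|y''V] := wG y'' Gy''.
  (* If the maximum is attained off the neighbourhood, its modulus divided by |alpha| is at most 1 +
     th P, so w' = 0 will do. *)
  exists (y' w), 0; split => //.
  - by split; rewrite ?subr0 ?Normc.normc0 ?Normc.normc1 // expr0n /=; lra.
  - by have := dil _ _ _ w'1 b'E; rewrite mulrA; lra.
  have := smallw _ _ _ y''w (normc_char_le (T f) y''X).
  rewrite mulr0 sub0r normcN Normc.normc1 -/P; lra.
exists (y' w), (y'' w); split => //.
- exact: wX.
- by have := dil _ _ _ w'1 b'E; rewrite mulrA; lra.
have [w''1 _] := wX y'' y''X.
have h : normc (y'' (T f) / a - 1) <= e / normc a.
  by have := nearE _ _ y''V hf; rewrite mulfV.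
by have := dil _ _ _ w''1 h; rewrite mulr1; lra.
Qed.

Lemma preserverZ c f : c != 0 -> f \is a GRing.unit -> T (c *: f) = c *: T f.
Proof.
move=> c0 fu; apply/eqP; rewrite -subr_eq0; apply/eqP.
apply: (boundary_eq0 bG ssB) => y Gy; have yX := boundary_char bG Gy.
have a0 : y (T f) != 0 by apply: char_unit (preserver_unit fu).
have ca0 : c * y (T f) != 0 by rewrite mulf_neq0.
have : y (T (c *: f)) / (c * y (T f)) = 1.
  apply: (@phase_rigidity _ c) => //.
    rewrite Normc.normcM preserverZ_abs // Normc.normcV Normc.normcM mulfV //.
    by rewrite -Normc.normcM gt_eqF // normc_gt0.
  by move=> M M1 Mc; exact: peak_comparison.
move/divr1_eq => E; by rewrite charB // charZ // E subrr.
Qed.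

(** Test f against alpha f^-1, for which the product minus alpha is 0. *)
Lemma preserverV f : f \is a GRing.unit -> T f * T f^-1 = 1.
Proof.
move=> fu; have fVu : f^-1 \is a GRing.unit by rewrite unitrV.
have afu : alpha *: f^-1 \is a GRing.unit by rewrite scaler_unit // unitfE.
have : rho (T f * T (alpha *: f^-1) - alpha%:A) = 0.
  by rewrite preserver_norm // -scalerAr mulrV // subrr spectral_radius0.
move/spectral_radius_eq0 => /(_ ssB); rewrite preserverZ // -scalerAr -scalerBr.
move/(congr1 ( *:%R alpha^-1)); rewrite scaler0 scalerA mulVf // scale1r.
by move/eqP; rewrite subr_eq0 => /eqP.
Qed.

Lemma preserver1_sqr : T 1 * T 1 = 1.
Proof. by have := preserverV (unitr1 A); rewrite invr1. Qed.

(** Once T is homogeneous, replacing g by (alpha / c) g exchanges alpha for any nonzero c. *)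
Lemma preserver_norm_scalar f g c : f \is a GRing.unit -> g \is a GRing.unit ->
  rho (T f * T g - c%:A) = rho (f * g - c%:A).
Proof.
move=> fu gu; have [->|c0] := eqVneq c 0; first by rewrite !scale0r !subr0 preserver_normM.
have d0 : alpha / c != 0 by rewrite mulf_neq0 // invr_neq0.
have dgu : (alpha / c) *: g \is a GRing.unit by rewrite scaler_unit // unitfE.
have := preserver_norm fu dgu; rewrite preserverZ //.
have E (C : comBanachAlgType R) (u v : C) :
    u * ((alpha / c) *: v) - alpha%:A = (alpha / c) *: (u * v - c%:A).
  by rewrite scalerBr scalerA divfK // scalerAr.
rewrite !E !spectral_radiusZ => /mulfI; apply.
by rewrite gt_eqF // normc_gt0.
Qed.

End Preserver.

Section PeakDisc.
Context (R : realType).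
Implicit Types (v w : R[i]) (r e : R).

Lemma sqr_normc_sub_real v r : normc (v - r%:C) ^+ 2 = normc v ^+ 2 - 2 * r * Re v + r ^+ 2.
Proof. by rewrite !sqr_normcE; case: v => a b /=; ring. Qed.

Lemma peak_disc_center w : in_peak_disc w -> normc (w - (9^-1)%:C) <= 8 / 9.
Proof.
move=> [_ wD]; rewrite -(@ler_pXn2r _ 2) ?nnegrE ?normc_ge0 ?divr_ge0 //.
move: wD; rewrite normcB sqr_normc_sub1 sqr_normc_sub_real; lra.
Qed.

Lemma peak_disc_boundary v : normc v = 1 -> normc (v - (9^-1)%:C) <= 8 / 9 -> v = 1.
Proof.
move=> v1; rewrite -(@ler_pXn2r _ 2) ?nnegrE ?normc_ge0 ?divr_ge0 //.
by rewrite sqr_normc_sub_real v1 => h; apply: eq1_of_Re => //; lra.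
Qed.

(* The disc is internally tangent to the unit circle at 1, so it meets its image under inversion only there. *)
Lemma peak_disc_inv v e : 0 <= e <= 1 -> v != 0 ->
  normc (v - (9^-1)%:C) <= 8 / 9 + e -> normc (v^-1 - (9^-1)%:C) <= 8 / 9 + e ->
  normc (v - 1) ^+ 2 <= 200 * e.
Proof.
move=> /andP[e0 e1] v0 h1 h2; set N := normc v ^+ 2.
have N0 : 0 < N by rewrite exprn_gt0 // normc_gt0.
have e2 : e ^+ 2 <= e by rewrite expr2 ler_piMr.
have Nle : N <= 1 + 3 * e.
  have : normc v <= 1 + e.
    have := ler_normcD (v - (9^-1)%:C) (9^-1)%:C; rewrite subrK normc_id ?invr_ge0 //; lra.
  by move/(sqr_le_add (normc_ge0 v)); rewrite expr1n -/N; lra.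
have h3 : 1 - 2 * 9^-1 * Re v + 9^-1 ^+ 2 * N <= (8 / 9 + e) ^+ 2 * N.
  have -> : 1 - 2 * 9^-1 * Re v + 9^-1 ^+ 2 * N = normc (v^-1 - (9^-1)%:C) ^+ 2 * N.
    have -> : normc (v^-1 - (9^-1)%:C) ^+ 2 * N = normc (1 - (9^-1)%:C * v) ^+ 2.
      rewrite /N -exprMn -Normc.normcM mulrBl mulVf //.
    rewrite normcB sqr_normc_sub1 Normc.normcM exprMn normc_id ?invr_ge0 // -/N.
    have -> : Re ((9^-1)%:C * v) = 9^-1 * Re v by case: (v) => a b /=; ring.
    by ring.
  by rewrite ler_pM2r // lerXn2r ?nnegrE ?normc_ge0 // addr_ge0 // divr_ge0.
rewrite sqr_normc_sub1 -/N.
have h4 : e * N <= 4 * e by rewrite mulrC ler_wpM2r //; lra.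
have h5 : e ^+ 2 * N <= 4 * e.
  by apply: le_trans h4; rewrite ler_wpM2r // ltW.
lra.
Qed.

End PeakDisc.

(** * Additivity and multiplicativity on the invertible group *)

Section PreserverHom.
Context (R : realType) (A B : comBanachAlgType R) (T : A -> B) (alpha : R[i]).
Context (ssA : semisimple A)
  (T_onto : T @` [set f | f \is a GRing.unit] = [set g | g \is a GRing.unit])
  (alpha0 : alpha != 0)
  (T_per : forall f g : A, f \is a GRing.unit -> g \is a GRing.unit ->
     peripheral_spectrum (T f * T g - alpha%:A) `&`
     peripheral_spectrum (f * g - alpha%:A) !=set0).
Context (G : set {ptws B -> R[i]}) (bG : boundary G) (pG : peaking G).

Let TU := preserver_unit T_onto.
Let TS := preserver_surj T_onto.
Let ssB := semisimple_range ssA T_onto alpha0 T_per.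
Let T11 : T 1 * T 1 = 1.
Proof. exact: (preserver1_sqr ssA T_onto alpha0 T_per bG pG). Qed.
Let TVE f : f \is a GRing.unit -> T f * T f^-1 = 1.
Proof. exact: (preserverV ssA T_onto alpha0 T_per bG pG). Qed.
Let Trho f g c : f \is a GRing.unit -> g \is a GRing.unit -> rho (T f * T g - c%:A) = rho (f * g - c%:A).
Proof. exact: (preserver_norm_scalar ssA T_onto alpha0 T_per bG pG). Qed.

(** As T 1 squares to 1, this is also T f / T 1. *)
Definition normalized f := T f * T 1.
Local Notation S := normalized.

Lemma normalized_unit f : f \is a GRing.unit -> S f \is a GRing.unit.
Proof. by move=> fu; rewrite unitrM !TU // unitr1. Qed.

Lemma normalizedV f : f \is a GRing.unit -> S f * S f^-1 = 1.
Proof. by move=> fu; rewrite /normalized mulrACA TVE // T11 mulr1. Qed.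

(** The character x depends on the list and on d. This suffices, because an algebraic identity in A
    involves finitely many elements and passes to their images at y0 up to a multiple of d. *)
Lemma approx_eval y0 (fs : seq A) d : G y0 -> (forall f, f \in fs -> f \is a GRing.unit) -> 0 < d ->
  exists2 x : {ptws A -> R[i]}, characters A x &
    forall f, f \in fs -> normc (x f - y0 (S f)) <= d.
Proof.
move=> Gy0 fsu d0; have y0X := boundary_char bG Gy0.
pose s f : R[i] := y0 (S f).
have s0 f : f \in fs -> 0 < normc (s f).
  by move=> /fsu fu; rewrite normc_gt0; apply: char_unit (normalized_unit fu).
have sV f : f \in fs -> s f^-1 = (s f)^-1.
  move=> ffs; have fu := fsu f ffs; have := s0 f ffs; rewrite normc_gt0 => sf0.
  by apply: (mulfI sf0); rewrite mulfV // /s -(charM y0X) normalizedV // char1.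
(* [peak_disc_inv] bounds |x f / s f - 1|^2 by 200 eps, which this choice turns into |x f - s f| <=
   d. *)
pose eps f := Num.min 1 (d ^+ 2 / (200 * normc (s f) ^+ 2)).
have eps0 f : f \in fs -> 0 < eps f.
  by move=> /s0 sf0; rewrite lt_min ltr01 divr_gt0 ?exprn_gt0 ?mulr_gt0 ?exprn_gt0.
have [e e0 He] : exists2 e, 0 < e & forall f, f \in fs ->
    e * (1 + rho (S f)) <= eps f * normc (s f) /\
    e * (1 + rho (S f^-1)) <= eps f * normc (s f^-1).
  apply: common_eps => f ffs; have h := eps0 f ffs; have h' := s0 f ffs.
  have h'' : 0 < normc (s f^-1) by rewrite sV // Normc.normcV invr_gt0.
  have r1 : 0 < 1 + rho (S f) by rewrite ltr_pwDl // spectral_radius_ge0.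
  have r2 : 0 < 1 + rho (S f^-1) by rewrite ltr_pwDl // spectral_radius_ge0.
  exists (Num.min (eps f * normc (s f) / (1 + rho (S f)))
                  (eps f * normc (s f^-1) / (1 + rho (S f^-1)))).
    by rewrite lt_min !divr_gt0 // mulr_gt0.
  by move=> e' /andP[_]; rewrite le_min !ler_pdivlMr // => /andP[].
have [w [y1 [wu [Gy1 Vy1] y1w wX wG]]] :=
  peaking_unit bG pG ([seq S f | f <- fs] ++ [seq S f^-1 | f <- fs]) Gy0 e0.
have [a au Ta] : exists2 a, a \is a GRing.unit & T a = w * T 1.
  by apply: TS; rewrite unitrM wu TU // unitr1.
have rhoE f c : f \is a GRing.unit -> rho (f * a - c%:A) = rho (w * S f - c%:A).
  by move=> fu; rewrite -Trho // Ta /normalized mulrCA.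
have S1 : S 1 = 1 by rewrite /normalized T11.
have y1X := boundary_char bG Gy1.
have wrho : rho w = 1.
  apply/eqP; rewrite eq_le; apply/andP; split.
    by apply: spectral_radius_le => y yX; case: (wX y yX).
  by have := normc_char_le w y1X; rewrite y1w Normc.normc1.
have arho : rho a = 1.
  by have := rhoE 1 0 (unitr1 _); rewrite S1 !scale0r !subr0 mul1r mulr1 wrho.
have [x xX xa1] := spectral_radius_attained a; rewrite arho in xa1.
(* |x a| = 1, and rho (a - 1/9) = rho (w - 1/9) <= 8/9 puts x a in the disc, which meets the unit
   circle at 1 only. *)
have xa : x a = 1.
  apply: peak_disc_boundary => //; rewrite -(char_scalar xX (9^-1)%:C) -charB //.
  apply: le_trans (normc_char_le _ xX) _.
  rewrite -[a]mul1r rhoE ?unitr1 // S1 mulr1; apply: spectral_radius_le => y yX.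
  by rewrite charB // char_scalar //; apply: peak_disc_center; exact: wX.
exists x => // f ffs; have fu := fsu f ffs.
(* As x a = 1, x g is the value of g a at x, so its distance from s g / 9 is at most rho (w S g - s
   g / 9). At a point of G either w is small, or S g is close to s g and w lies in the disc. *)
have key g : g \is a GRing.unit -> S g \in [seq S f | f <- fs] ++ [seq S f^-1 | f <- fs] ->
    0 < normc (s g) -> e * (1 + rho (S g)) <= eps f * normc (s g) ->
    normc (x g / s g - (9^-1)%:C) <= 8 / 9 + eps f.
  move=> gu gS sg0 eg; have sg : s g != 0 by rewrite -normc_gt0.
  rewrite -(ler_pM2r sg0) -Normc.normcM mulrBl divfK // mulrDl.
  have -> : x g - (9^-1)%:C * s g = x (g * a - ((9^-1)%:C * s g)%:A).
    by rewrite charB // charM // xa mulr1 char_scalar.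
  apply: le_trans (normc_char_le _ xX) _; rewrite rhoE //.
  apply: le_trans (_ : 8 / 9 * normc (s g) + e * (1 + rho (S g)) <= _); last by rewrite lerD2l.
  have [_ /(_ (w * S g - ((9^-1)%:C * s g)%:A)) [y Gy <-]] := bG.
  have yX := boundary_char bG Gy; have [yw1 _] := wX y yX.
  rewrite charB // charM // char_scalar //.
  have r0 := spectral_radius_ge0 (S g).
  have er0 : 0 <= e * rho (S g) by rewrite mulr_ge0 // ltW.
  have [yw|yV] := wG y Gy.
    apply: le_trans (ler_normcD _ _) _; rewrite normcN !Normc.normcM normc_id ?invr_ge0 //.
    have : normc (y w) * normc (y (S g)) <= e * rho (S g).
      by rewrite ler_pM ?normc_ge0 // normc_char_le.
    by lra.
  have idE (u v t p : R[i]) : u * v - p * t = t * (u - p) + u * (v - t) by ring.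
  rewrite idE.
  apply: le_trans (ler_normcD _ _) _; rewrite !Normc.normcM.
  have h1 : normc (s g) * normc (y w - (9^-1)%:C) <= normc (s g) * (8 / 9).
    by rewrite ler_wpM2l ?normc_ge0 // peak_disc_center //; exact: wX.
  have h2 : normc (y w) * normc (y (S g) - s g) <= 1 * e.
    by rewrite ler_pM ?normc_ge0 // ltW // yV.
  by lra.
have [He1 He2] := He f ffs; have sf0 := s0 f ffs.
have sfn0 : s f != 0 by rewrite -normc_gt0.
have k1 : normc (x f / s f - (9^-1)%:C) <= 8 / 9 + eps f.
  by apply: key => //; rewrite mem_cat map_f.
have k2 : normc ((x f / s f)^-1 - (9^-1)%:C) <= 8 / 9 + eps f.
  have -> : (x f / s f)^-1 = x f^-1 / s f^-1 by rewrite invfM sV // (charV xX).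
  apply: key; rewrite ?unitrV // ?mem_cat ?sV // ?Normc.normcV ?invr_gt0 //.
  by apply/orP; right; apply/mapP; exists f.
have := peak_disc_inv _ _ k1 k2; rewrite (ltW (eps0 f ffs)) ge_min lexx /= => /(_ isT).
rewrite mulf_neq0 ?invr_neq0 // ?char_unit // => /(_ isT) h.
rewrite -(@ler_pXn2r _ 2) ?nnegrE ?normc_ge0 ?(ltW d0) // -/(s f).
have -> : x f - s f = (x f / s f - 1) * s f by rewrite mulrBl divfK // mul1r.
rewrite Normc.normcM exprMn.
have : eps f <= d ^+ 2 / (200 * normc (s f) ^+ 2) by rewrite ge_min lexx orbT.
have D0 : 0 < normc (s f) ^+ 2 by rewrite exprn_gt0.
rewrite ler_pdivlMr ?mulr_gt0 // => h'.
apply: le_trans (_ : 200 * eps f * normc (s f) ^+ 2 <= _); first by rewrite ler_pM2r.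
by apply: le_trans h'; rewrite le_eqVlt; apply/orP; left; apply/eqP; ring.
Qed.

Lemma normalizedD f g : f \is a GRing.unit -> g \is a GRing.unit -> f + g \is a GRing.unit ->
  S (f + g) = S f + S g.
Proof.
move=> fu gu fgu; apply/eqP; rewrite -subr_eq0; apply/eqP.
apply: (boundary_eq0 bG ssB) => y Gy; have yX := boundary_char bG Gy.
apply: (@eq0_of_eps _ _ 3) => // e e0.
have [|x xX Hx] := @approx_eval y [:: f; g; f + g] e Gy _ e0.
  by move=> h; rewrite !inE => /or3P[] /eqP ->.
have h1 := Hx f; have h2 := Hx g; have h3 := Hx (f + g).
rewrite !inE !eqxx ?orbT in h1 h2 h3.
rewrite charB // charD //.
have -> : y (S (f + g)) - (y (S f) + y (S g)) =
    (x f - y (S f)) + ((x g - y (S g)) - (x (f + g) - y (S (f + g)))).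
  by rewrite charD //; ring.
have := ler_normcD (x f - y (S f)) ((x g - y (S g)) - (x (f + g) - y (S (f + g)))).
have := ler_normcD (x g - y (S g)) (- (x (f + g) - y (S (f + g)))); rewrite normcN.
have := h1 isT; have := h2 isT; have := h3 isT; lra.
Qed.

Lemma normalizedM f g : f \is a GRing.unit -> g \is a GRing.unit -> S (f * g) = S f * S g.
Proof.
move=> fu gu; apply/eqP; rewrite -subr_eq0; apply/eqP.
have fgu : f * g \is a GRing.unit by rewrite unitrM fu.
apply: (boundary_eq0 bG ssB) => y Gy; have yX := boundary_char bG Gy.
apply: (@eq0_of_eps _ _ (rho g + normc (y (S f)) + 1)) => [|e e0].
  by rewrite !addr_ge0 ?normc_ge0 ?spectral_radius_ge0.
have [|x xX Hx] := @approx_eval y [:: f; g; f * g] e Gy _ e0.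
  by move=> h; rewrite !inE => /or3P[] /eqP ->.
have h1 := Hx f; have h2 := Hx g; have h3 := Hx (f * g).
rewrite !inE !eqxx ?orbT in h1 h2 h3.
rewrite charB // charM //.
have idE (u v p q r : R[i]) :
    r - p * q = (u - p) * v + (p * (v - q) - (u * v - r)) by ring.
rewrite (idE (x f) (x g)) -(charM xX).
have := ler_normcD ((x f - y (S f)) * x g) (y (S f) * (x g - y (S g)) - (x (f * g) - y (S (f * g)))).
have := ler_normcD (y (S f) * (x g - y (S g))) (- (x (f * g) - y (S (f * g)))).
rewrite normcN !Normc.normcM.
have : normc (x f - y (S f)) * normc (x g) <= e * rho g.
  by rewrite ler_pM ?normc_ge0 ?normc_char_le // h1.
have : normc (y (S f)) * normc (x g - y (S g)) <= normc (y (S f)) * e.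
  by rewrite ler_wpM2l ?normc_ge0 // h2.
have := h3 isT; lra.
Qed.

Lemma normalizedZ c f : c != 0 -> f \is a GRing.unit -> S (c *: f) = c *: S f.
Proof.
move=> c0 fu; rewrite /normalized (preserverZ ssA T_onto alpha0 T_per bG pG) //.
by rewrite scalerAl.
Qed.

Lemma normalized1 : S 1 = 1. Proof. exact: T11. Qed.

Lemma normalized_surj b : b \is a GRing.unit -> exists2 f, f \is a GRing.unit & S f = b.
Proof.
move=> bu; have [f fu Tf] : exists2 f, f \is a GRing.unit & T f = b * T 1.
  by apply: TS; rewrite unitrM bu TU // unitr1.
by exists f => //; rewrite /normalized Tf -mulrA T11 mulr1.
Qed.

(** If T f = T g, then rho (f g^-1 - 1) = rho (T g T g^-1 - 1) = 0. *)
Lemma normalized_inj f g : f \is a GRing.unit -> g \is a GRing.unit -> S f = S g -> f = g.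
Proof.
move=> fu gu /(congr1 (fun h => h * T 1)).
rewrite /normalized -!mulrA T11 !mulr1 => Tfg.
have gVu : g^-1 \is a GRing.unit by rewrite unitrV.
have : rho (f * g^-1 - 1%:A) = 0.
  by rewrite -Trho // Tfg TVE // scale1r subrr -(scale0r (0 : B)) spectral_radiusZ Normc.normc0 mul0r.
move/spectral_radius_eq0 => /(_ ssA) /eqP; rewrite scale1r subr_eq0 => /eqP /(congr1 ( *%R^~ g)).
by rewrite mulrVK // mul1r.
Qed.

End PreserverHom.

Definition is_calg_hom (R : realType) (A B : comBanachAlgType R) (E : A -> B) : Prop :=
  [/\ forall (c : R[i]) f g, E (c *: f + g) = c *: E f + E g,
      forall f g, E (f * g) = E f * E g & E 1 = 1].

Lemma shift_mul (R : realType) (C : comBanachAlgType R) (x y : C) (a b : R[i]) :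
  (x + a%:A) * (y + b%:A) = x * y + (b *: x + (a *: y + (a * b)%:A)).
Proof. by rewrite mulrDr !mulrDl !mulr_algl mulr_algr scalerA; ring. Qed.

(** * Extension from the invertible group to the algebra *)

Section UnitHomExtension.
Context (R : realType) (A B : comBanachAlgType R) (S : A -> B).
Context (SD : forall f g, f \is a GRing.unit -> g \is a GRing.unit -> f + g \is a GRing.unit -> S (f + g) = S f + S g)
  (SM : forall f g, f \is a GRing.unit -> g \is a GRing.unit -> S (f * g) = S f * S g)
  (SZ : forall (c : R[i]) f, c != 0 -> f \is a GRing.unit -> S (c *: f) = c *: S f)
  (S1 : S 1 = 1)
  (S_inj : forall f g, f \is a GRing.unit -> g \is a GRing.unit -> S f = S g -> f = g)
  (S_surj : forall b, b \is a GRing.unit -> exists2 f, f \is a GRing.unit & S f = b).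

Let shift (f : A) : R[i] := (rho f + 1)%:C.

Lemma scalar_shift_unit (C : comBanachAlgType R) (f : C) (r : R) :
  rho f < r -> f + (r%:C)%:A \is a GRing.unit.
Proof.
move=> fr; apply: addr_scalar_unit; rewrite normc_id //.
by apply: le_trans (ltW fr); exact: spectral_radius_ge0.
Qed.

Let shift_unit f : f + (shift f)%:A \is a GRing.unit.
Proof. by apply: scalar_shift_unit; rewrite ltrDl. Qed.

Let S_scalar (c : R[i]) : c != 0 -> S c%:A = c%:A.
Proof. by move=> c0; rewrite SZ ?unitr1 // S1. Qed.

Let S_shift f (c d : R[i]) : f + c%:A \is a GRing.unit -> f + d%:A \is a GRing.unit ->
  S (f + c%:A) - c%:A = S (f + d%:A) - d%:A.
Proof.
move=> fc fd; have [->//|cd] := eqVneq c d.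
have cd0 : c - d != 0 by rewrite subr_eq0.
have E : f + c%:A = (f + d%:A) + (c - d)%:A by rewrite scalerBl; ring.
rewrite E SD ?scalar_unit // -?E // S_scalar // scalerBl; ring.
Qed.

(** Adding a scalar beyond the spectral radius makes f invertible. Any other scalar that does so
    gives the same value, since the two shifts differ by an invertible scalar. *)
Definition unit_hom_extension f := S (f + (shift f)%:A) - (shift f)%:A.
Local Notation E := unit_hom_extension.

Lemma unit_hom_extensionE f (c : R[i]) : f + c%:A \is a GRing.unit -> E f = S (f + c%:A) - c%:A.
Proof. by move=> fc; apply: S_shift. Qed.

Lemma unit_hom_extension_unit f : f \is a GRing.unit -> E f = S f.
Proof. by move=> fu; have := @unit_hom_extensionE f 0; rewrite !scale0r addr0 subr0; apply. Qed.

Let ED f g : E (f + g) = E f + E g.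
Proof.
have fgu : f + g + (shift f + shift g)%:A \is a GRing.unit.
  rewrite /shift -rmorphD; apply: scalar_shift_unit.
  by have := spectral_radiusD f g; lra.
rewrite (unit_hom_extensionE fgu).
have eq : f + g + (shift f + shift g)%:A = (f + (shift f)%:A) + (g + (shift g)%:A).
  by rewrite scalerDl addrACA.
rewrite eq SD ?shift_unit -?eq //.
by rewrite scalerDl opprD addrACA.
Qed.

Let EZ (c : R[i]) f : E (c *: f) = c *: E f.
Proof.
have [->|c0] := eqVneq c 0.
  have := ED 0 0; rewrite addr0 => /eqP; rewrite -subr_eq subrr !scale0r => /eqP <-.
  by [].
have cu : c *: f + (c * shift f)%:A \is a GRing.unit.
  by rewrite -scalerA -scalerDr scaler_unit ?unitfE // shift_unit.
rewrite (unit_hom_extensionE cu) -scalerA -scalerDr SZ ?shift_unit //.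
by rewrite /unit_hom_extension scalerBr scalerA.
Qed.

Let E1 : E 1 = 1. Proof. by rewrite unit_hom_extension_unit ?unitr1. Qed.

(** Multiply the invertible shifts of f and g; the lower terms of the two expansions agree by
    linearity and cancel. *)
Let EM f g : E (f * g) = E f * E g.
Proof.
set u := f + (shift f)%:A; set v := g + (shift g)%:A.
have Eu : E u = E f + (shift f)%:A by rewrite ED EZ E1.
have Ev : E v = E g + (shift g)%:A by rewrite ED EZ E1.
have uu : u \is a GRing.unit by exact: shift_unit.
have vu : v \is a GRing.unit by exact: shift_unit.
have Euv : E (u * v) = E u * E v.
  by rewrite !unit_hom_extension_unit ?unitrM ?uu // SM.
move: Euv; rewrite Eu Ev /u /v !shift_mul !ED !EZ E1.
exact: addIr.
Qed.

Theorem unit_hom_extends : exists E : A -> B,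
  [/\ forall f, f \is a GRing.unit -> E f = S f, is_calg_hom E & bijective E].
Proof.
exists E; split; first exact: unit_hom_extension_unit.
  by split=> [c f g|f g|]; [rewrite ED EZ | exact: EM | exact: E1].
have E_inj f g : E f = E g -> f = g.
  move=> Efg; pose r := rho f + rho g + 1.
  have fu : f + (r%:C)%:A \is a GRing.unit.
    by apply: scalar_shift_unit; have := spectral_radius_ge0 g; rewrite /r; lra.
  have gu : g + (r%:C)%:A \is a GRing.unit.
    by apply: scalar_shift_unit; have := spectral_radius_ge0 f; rewrite /r; lra.
  move: Efg; rewrite (unit_hom_extensionE fu) (unit_hom_extensionE gu).
  by move/addIr/S_inj => /(_ fu gu) /addIr.
have E_surj b : exists f, E f = b.
  pose c : R[i] := (rho b + 1)%:C.
  have bu : b + c%:A \is a GRing.unit by apply: scalar_shift_unit; rewrite ltrDl.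
  have [u uu Su] := S_surj bu.
  exists (u - c%:A); rewrite ED -scaleNr EZ E1 unit_hom_extension_unit // Su.
  by rewrite scaleNr addrK.
have [F FE] := choice E_surj.
by exists F => [f|b] //; apply: E_inj; rewrite FE.
Qed.

End UnitHomExtension.

(** * Transport to the maximal ideal spaces *)

Section MaximalIdealSpace.
Context (R : realType) (A : comBanachAlgType R).

Lemma maxspec_char (x : maxspec A) : characters A (set_val x).
Proof. exact: set_valP. Qed.

Lemma gelfand_continuous (f : A) : continuous (@gelfand R A f).
Proof.
move=> x; apply: (@continuous_comp _ _ _ set_val (fun y : {ptws A -> R[i]} => y f)).
  exact: initial_continuous.
exact: (@proj_continuous A (fun=> R[i]) f).
Qed.

Lemma clP (h : maxspec A -> R[i]) : cl A h <->
  continuous h /\ forall e : R, 0 < e -> exists f, forall x, normc (gelfand f x - h x) < e.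
Proof.
split=> [[hc hcl]|[hc H]]; split=> //.
  move=> e e0.
  have nb : nbhs (h : {uniform maxspec A -> R[i]})
      [set g : {uniform maxspec A -> R[i]} | forall x, normc (g x - h x) < e].
    apply/uniform_nbhs; exists [set p : R[i] * R[i] | normc (p.2 - p.1) < e].
    split; last by move=> g Hg x; exact: Hg.
    rewrite -entourage_from_ballE; exists e%:C => /=; first by rewrite ltcR.
    by move=> [a b] /=; rewrite -ball_normE /= -ltcR normcB.
  have [_ [[f _ <-] Hf]] := hcl _ nb.
  by exists f.
move=> P /uniform_nbhs [E [entE HE]].
move: entE; rewrite -entourage_from_ballE => -[d /= d0 Hd].
have dr : (complex.Re d)%:C = d by rewrite RRe_real // gtr0_real.
have d0' : 0 < complex.Re d by rewrite -ltcR dr.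
have [f Hf] := H _ d0'.
exists (gelfand f); split; first by exists f.
apply: HE => x _; apply: Hd; rewrite /= -ball_normE /= -dr.
by change ((normc (h x - gelfand f x))%:C < (complex.Re d)%:C); rewrite ltcR normcB.
Qed.

Lemma cl_gelfandM (g : A) h : cl A h -> cl A (fun x => gelfand g x * h x).
Proof.
move=> /clP [hc H]; apply/clP; split.
  move=> x; apply: cvgM; [exact: (nbhs_filter x) | | exact: hc].
  exact: (@gelfand_continuous g x).
move=> e e0; have b0 : 0 < bnorm g + 1 by rewrite ltr_wpDl // bnorm_ge0.
have [f Hf] := H _ (divr_gt0 e0 b0).
exists (g * f) => x; have xX := maxspec_char x.
have -> : gelfand (g * f) x - gelfand g x * h x = gelfand g x * (gelfand f x - h x).
  by rewrite mulrBr /gelfand (charM xX).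
rewrite Normc.normcM; apply: le_lt_trans (_ : bnorm g * (e / (bnorm g + 1)) < _).
  by rewrite ler_pM ?normc_ge0 // ?(char_le_bnorm xX) // ltW.
rewrite mulrCA gtr_pMr // ltr_pdivrMr // mul1r ltrDl //.
Qed.

End MaximalIdealSpace.

(** Composing arguments with psi turns states of M into states of N, so a convex decomposition of
    evaluation at phi y becomes one of evaluation at y. *)
Lemma choquet_homeo (R : realType) (X Y : Type) (M : set (X -> R[i])) (N : set (Y -> R[i]))
    (phi : Y -> X) (psi : X -> Y) : cancel phi psi -> cancel psi phi ->
  (forall h, M h -> N (h \o phi)) -> (forall k, N k -> M (k \o psi)) ->
  forall y, choquet N y -> choquet M (phi y).
Proof.
move=> phiK psiK MN NM y yN L1 L2 t s1 s2 t01 H h Mh.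
have state L : is_state M L -> is_state N (fun k => L (k \o psi)).
  move=> [Llin L1' Lb]; split.
  - by move=> a k l Nk Nl; rewrite -Llin //; exact: NM.
  - exact: L1'.
  - by move=> k r Nk kr; apply: Lb; [exact: NM | move=> x; exact: kr].
have Hy k : N k -> k y = t%:C * L1 (k \o psi) + (1 - t)%:C * L2 (k \o psi).
  by move=> Nk; rewrite -H; [rewrite /= phiK | exact: NM].
have := yN _ _ t (state _ s1) (state _ s2) t01 Hy (h \o phi) (MN h Mh).
have -> : (h \o phi) \o psi = h by apply/funext => x /=; rewrite psiK.
by [].
Qed.

Section DualMap.
Context (R : realType) (A B : comBanachAlgType R) (E : A -> B) (homE : is_calg_hom E).

Lemma dual_char (y : maxspec B) : characters A (fun f => set_val y (E f)).
Proof.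
have yX := maxspec_char y; have [El EM E1] := homE.
split; first by move=> c f g; rewrite El (char_linear yX).
by split=> [|f g]; rewrite ?E1 ?(char1 yX) // EM (charM yX).
Qed.

Definition dual_map (y : maxspec B) : maxspec A := SigSub (mem_set (dual_char y)).

Lemma gelfand_dual f y : gelfand f (dual_map y) = gelfand (E f) y.
Proof. by []. Qed.

Lemma dual_map_continuous : continuous dual_map.
Proof.
apply: continuous_comp_initial => y; apply/cvg_sup; first exact/fmap_filter/nbhs_filter.
move=> f U [V] [[W] oW <-] Wy WU.
apply: (filterS WU); first exact/fmap_filter/nbhs_filter.
apply: (@gelfand_continuous _ _ (E f) y W).
by apply: open_nbhs_nbhs; split.
Qed.

Lemma cl_dual h : cl A h -> cl B (h \o dual_map).
Proof.
move=> /clP [hc H]; apply/clP; split.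
  by move=> y; apply: continuous_comp; [exact: dual_map_continuous | exact: hc].
by move=> e e0; have [f Hf] := H e e0; exists (E f) => y; exact: Hf.
Qed.

End DualMap.

Lemma dual_mapK (R : realType) (A B : comBanachAlgType R) (E : A -> B) (F : B -> A)
    (homE : is_calg_hom E) (homF : is_calg_hom F) :
  cancel E F -> cancel (dual_map homF) (dual_map homE).
Proof.
move=> EF x; apply: val_inj; apply/funext => f.
by change (set_val x (F (E f)) = set_val x f); rewrite EF.
Qed.

Lemma calg_hom_inv (R : realType) (A B : comBanachAlgType R) (E : A -> B) (F : B -> A) :
  is_calg_hom E -> cancel E F -> cancel F E -> is_calg_hom F.
Proof.
move=> [El EM E1] EF FE; split=> [c f g|f g|].
- by apply: (can_inj EF); rewrite El !FE.
- by apply: (can_inj EF); rewrite EM !FE.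
- by rewrite -E1 EF.
Qed.

Lemma subtype_homeomorphism (X Y : topologicalType) (P : set X) (Q : set Y)
    (f : X -> Y) (g : Y -> X) (fP : forall x, P x -> Q (f x)) (gQ : forall y, Q y -> P (g y)) :
  continuous f -> continuous g -> cancel f g -> cancel g f ->
  homeomorphism (fun x : P => SigSub (mem_set (fP _ (set_valP x))) : Q).
Proof.
move=> fc gc fK gK; split.
  apply: continuous_comp_initial => x.
  apply: (@continuous_comp _ _ _ set_val f); [exact: initial_continuous | exact: fc].
exists (fun y : Q => SigSub (mem_set (gQ _ (set_valP y))) : P); split.
- apply: continuous_comp_initial => y.
  apply: (@continuous_comp _ _ _ set_val g); [exact: initial_continuous | exact: gc].
- by move=> x; apply: val_inj; exact: fK.
- by move=> y; apply: val_inj; exact: gK.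
Qed.

Theorem corollary6p1 (R : realType) (A B : comBanachAlgType R)
    (T : A -> B) (alpha : R[i]) :
  semisimple A ->
  T @` [set f | f \is a GRing.unit] = [set g | g \is a GRing.unit] ->
  alpha != 0 ->
  (forall f g : A, f \is a GRing.unit -> g \is a GRing.unit ->
     peripheral_spectrum (T f * T g - alpha%:A) `&`
     peripheral_spectrum (f * g - alpha%:A) !=set0) ->
  semisimple B /\
  exists TE : (maxspec A -> R[i]) -> (maxspec B -> R[i]),
    [/\ forall f : A, f \is a GRing.unit -> TE (gelfand f) = gelfand (T f),
        TE @` cl A = cl B,
        TE @` hat A = hat B,
        exists2 phi : choquet (cl B) -> choquet (cl A),
          homeomorphism phi &
          forall f, cl A f -> forall y : choquet (cl B),
            TE f (set_val y) = gelfand (T 1) (set_val y) * f (set_val (phi y))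
      & let S f := fun y => TE f y / gelfand (T 1) y in
        [/\ calg_iso (cl A) (cl B) S,
            forall f : A, f \is a GRing.unit -> S (gelfand f) = gelfand (T f / T 1)
          & S @` hat A = hat B]].
Proof.
move=> ssA T_onto alpha0 T_per.
split; first exact: semisimple_range ssA T_onto alpha0 T_per.
have [G [bG pG]] := exists_peaking_boundary B.
have T11 := preserver1_sqr ssA T_onto alpha0 T_per bG pG.
have [E [ES homE [F EF FE]]] := unit_hom_extends
  (normalizedD ssA T_onto alpha0 T_per bG pG) (normalizedM ssA T_onto alpha0 T_per bG pG)
  (normalizedZ ssA T_onto alpha0 T_per bG pG) (normalized1 ssA T_onto alpha0 T_per bG pG)
  (normalized_inj ssA T_onto alpha0 T_per bG pG) (normalized_surj ssA T_onto alpha0 T_per bG pG).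
have homF := calg_hom_inv homE EF FE.
pose Phi := dual_map homE; pose Psi := dual_map homF.
have PhiK : cancel Phi Psi by exact: dual_mapK.
have PsiK : cancel Psi Phi by exact: dual_mapK.
have T1n0 y : gelfand (T 1) y != 0.
  by apply: (char_unit (maxspec_char y)); exact: (preserver_unit T_onto (unitr1 A)).
have T1T1 y : gelfand (T 1) y * gelfand (T 1) y = 1.
  by rewrite /gelfand -(charM (maxspec_char y)) T11 (char1 (maxspec_char y)).
(* The weighted composition is defined on all of M_B, with Phi the homeomorphism dual to [E]; phi is
   its restriction to the Choquet boundaries. *)
pose TE (f : maxspec A -> R[i]) := fun y => gelfand (T 1) y * f (Phi y).
have TE_hat f : TE (gelfand f) = gelfand (T 1 * E f).
  by apply/funext => y; rewrite /TE gelfand_dual /gelfand (charM (maxspec_char y)).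
have TE_unit f : f \is a GRing.unit -> TE (gelfand f) = gelfand (T f).
  by move=> fu; rewrite TE_hat ES // /normalized mulrCA T11 mulr1.
have SE f : (fun y => TE f y / gelfand (T 1) y) = f \o Phi.
  by apply/funext => y; rewrite /TE mulrAC mulfV // mul1r.
have clPsi h : cl B h -> cl A (h \o Psi) by exact: cl_dual.
have clPhi h : cl A h -> cl B (h \o Phi) by exact: cl_dual.
have PhiPsi (h : maxspec A -> R[i]) : (h \o Phi) \o Psi = h.
  by apply/funext => x /=; rewrite PsiK.
have PsiPhi (h : maxspec B -> R[i]) : (h \o Psi) \o Phi = h.
  by apply/funext => x /=; rewrite PhiK.
exists TE; split.
- exact: TE_unit.
- apply/seteqP; split=> [_ [f fA <-]|h hB]; first exact: cl_gelfandM (clPhi f fA).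
  (* T 1 is its own inverse, so multiplying by it before composing with Psi undoes the weight. *)
  exists ((fun y => gelfand (T 1) y * h y) \o Psi); first exact/clPsi/cl_gelfandM.
  by apply/funext => y; rewrite /TE /= PhiK mulrA T1T1 mul1r.
- apply/seteqP; split=> [_ [_ [f _ <-] <-]|_ [b _ <-]]; first by rewrite TE_hat; exists (T 1 * E f).
  exists (gelfand (F (T 1 * b))); first by exists (F (T 1 * b)).
  by rewrite TE_hat FE mulrA T11 mul1r.
- have fP := choquet_homeo PhiK PsiK clPhi clPsi; have gP := choquet_homeo PsiK PhiK clPsi clPhi.
  exists (fun y : choquet (cl B) => SigSub (mem_set (fP _ (set_valP y))) : choquet (cl A)).
    by apply: (subtype_homeomorphism fP gP) => //; exact: dual_map_continuous.
  by [].
move=> S; have {}SE f : S f = f \o Phi by exact: SE.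
split.
- split.
  + split.
    * by move=> f fA; rewrite SE; exact: clPhi.
    * by move=> f g _ _; rewrite !SE => fg; rewrite -(PhiPsi f) fg PhiPsi.
    * by move=> h hB; exists (h \o Psi); [exact: clPsi | rewrite SE PsiPhi].
  + by move=> a h k _ _; rewrite !SE.
  + by move=> h k _ _; rewrite !SE.
  + by rewrite SE.
- move=> f fu; apply/funext => y; rewrite /S TE_unit //; have yX := maxspec_char y.
  by rewrite /gelfand (charM yX) (charV yX) //; exact: (preserver_unit T_onto (unitr1 A)).
apply/seteqP; split=> [_ [_ [f _ <-] <-]|_ [b _ <-]]; first by rewrite SE; exists (E f).
exists (gelfand (F b)); first by exists (F b).
by rewrite SE; apply/funext => y; rewrite /= gelfand_dual FE.
Qed.
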